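(* Let $E$ be a set of $n$ points in $\mathbb{R}^3$ such that every plane contains at most $p$ points of $E$. Then the number of right angle 2-chains in $E$, i.e. of tuples $(x_1,x_2,x_3,x_4)\in E^4$ with $\angle(x_1,x_2,x_3)=\angle(x_2,x_3,x_4)=\pi/2$, is $\lesssim p\,n^{7/3}$.
   Context: $\angle(x,y,z)\in[0,\pi]$ denotes the angle at $y$ between $x-y$ and $z-y$ (for $x\ne y\ne z$). $X\lesssim Y$ means $X\le CY$ for all $n>N$ with constants $C,N$ independent of $n$ and $p$. *)

(* Defs.v *)
From HB Require Import structures.
From mathcomp Require Import all_boot all_order all_algebra finmap.
From mathcomp Require Import all_classical all_reals all_analysis.

Set Implicit Arguments.
Unset Strict Implicit.
Unset Printing Implicit Defensive.

Import Order.TTheory GRing.Theory Num.Theory.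
Local Open Scope ring_scope.

Definition dot (R : realType) (d : nat) (u v : 'rV[R]_d) : R :=
  \sum_(i < d) u 0 i * v 0 i.

(* The norm `|u| that the library puts on 'rV[R]_d is the sup norm. *)
Definition enorm (R : realType) (d : nat) (u : 'rV[R]_d) : R :=
  Num.sqrt (dot u u).

(* Only meaningful for x != y and z != y: in the degenerate cases the division
   by zero yields acos 0 = pi / 2, so uses below carry the nondegeneracy. *)
Definition angle (R : realType) (d : nat) (x y z : 'rV[R]_d) : R :=
  acos (dot (x - y) (z - y) / (enorm (x - y) * enorm (z - y))).

Definition right_angle (R : realType) (d : nat) (x y z : 'rV[R]_d) : bool :=
  [&& x != y, y != z & angle x y z == pi / 2].

(* A plane in R^3, given by a normal vector a and an offset b. *)
Definition is_plane (R : realType) (P : set 'rV[R]_3) : Prop :=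
  exists (a : 'rV[R]_3) (b : R),
    a != 0 /\ P = [set x : 'rV[R]_3 | dot a x = b]%classic.

Definition right_angle_2chains (R : realType) (d : nat) (E : {fset 'rV[R]_d}) :
    {fset 'rV[R]_d * 'rV[R]_d * 'rV[R]_d * 'rV[R]_d} :=
  [fset t in E `*` E `*` E `*` E |
    let: (x1, x2, x3, x4) := t in
    right_angle x1 x2 x3 && right_angle x2 x3 x4]%fset.

(* Main.v *)
Require Import Defs.
From HB Require Import structures.
From mathcomp Require Import all_boot all_order all_algebra finmap.
From mathcomp Require Import all_classical all_reals all_analysis.
From mathcomp Require Import ring lra zify.

(* A right angle is a pair of orthogonal lines through its vertex q.
   Projecting the directions at q centrally to a plane turns orthogonality into
   point-line incidence, so the Szemeredi-Trotter theorem (proved from the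
   crossing lemma, with no appeal to Euler's formula) bounds the pairs.  Directions
   carrying many points are handled dyadically: at most O(n^2 / k^3) lines hold
   k <= n^(1/2) points, again by Szemeredi-Trotter, and for k > n^(1/3) it is
   enough that each point has a single foot on each line.  This gives
   O(n^(7/3)) right angles, and each extends to at most p chains because x_4
   lies in the plane through x_3 orthogonal to x_2 - x_3. *)

Set Implicit Arguments.
Unset Strict Implicit.
Unset Printing Implicit Defensive.

Import Order.TTheory GRing.Theory Num.Theory.
Local Open Scope ring_scope.

(** * Crossing lemma and Szemeredi-Trotter *)

(** The cut at n^(1/3) is where two bounds meet. Let J(k) count the incidences between points and
    lines with at least k points, so that J(k) = O(n^2 / k^2) for k <= n^(1/2). Feet of
    perpendiculars bound the right angles with an arm on a line of at least k points by n J(k),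
    which is O(n^(7/3)) as soon as k >= n^(1/3). When the arms lie on lines with about A >= B
    points, each orthogonal pair of directions carries about A B pairs of end points, and the linear
    term of Szemeredi-Trotter alone gives A B J(B), up to n^2 A / B; for B = 1 this is affordable
    only when A <= n^(1/3). The averaging parameter m of the crossing lemma stays a free positive
    integer in all incidence bounds and is fixed only where they are used, which keeps the counting
    in natural numbers. Classes go by powers of 8 and n is compared with 8^t, so that the best m, of
    order (n A^2 / B^3)^(1/3), becomes exactly a power of 2. *)

Lemma leq_card_rel (T T' : finType) (A : {set T}) (B : {set T'})
    (r : T -> T' -> Prop) :
  (forall x, x \in A -> exists2 y, y \in B & r x y) ->
  (forall x x' y, x \in A -> x' \in A -> r x y -> r x' y -> x = x') ->
  (#|A| <= #|B|)%N.
Proof.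
move=> rtot rinj.
pose f x := [pick y in B | `[< r x y >]].
have fP x : x \in A -> exists y, [/\ f x = Some y, y \in B & r x y].
  move=> /rtot[y By rxy]; rewrite /f; case: pickP => [z /andP[Bz /asboolP rxz]|].
    by exists z.
  by move=> /(_ y); rewrite By (asboolT rxy).
have finj : {in A &, injective f}.
  move=> x x' Ax Ax' /=; have [y [-> _ rxy]] := fP x Ax.
  by have [y' [-> _ rxy']] := fP x' Ax' => -[yy']; apply: (rinj x x' y) => //; rewrite yy'.
rewrite -(card_in_imset finj) -(card_imset (mem B) Some_inj); apply: subset_leq_card.
apply/fintype.subsetP => _ /imsetP[x Ax ->]; have [y [-> By _]] := fP x Ax.
exact: imset_f.
Qed.

(** * Straight-line graph joining consecutive points on non-vertical lines *)

Section PlanarGraph.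
Context {R : realFieldType} {V W : finType} (X Y : V -> R) (a b : W -> R).
Implicit Types (e f g : V * V * W) (u v w : V) (k l : W).

Definition ordinate l (x : R) : R := a l * x + b l.

Definition incident v l : bool := Y v == ordinate l (X v).

Definition is_edge e : bool :=
  [&& X e.1.1 < X e.1.2, incident e.1.1 e.2, incident e.1.2 e.2 &
      [forall w, incident w e.2 ==> ~~ (X e.1.1 < X w < X e.1.2)]].

Definition abscissa_meet k l : R := (b l - b k) / (a k - a l).

Definition spans e (x : R) : bool := X e.1.1 < x < X e.1.2.

Definition cross e f : bool :=
  [&& a e.2 != a f.2, spans e (abscissa_meet e.2 f.2) &
      spans f (abscissa_meet e.2 f.2)].

Lemma ordinate_sub k l x : a k != a l ->
  ordinate k x - ordinate l x = (a k - a l) * (x - abscissa_meet k l).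
Proof.
move=> akl; rewrite /ordinate /abscissa_meet; field.
by rewrite subr_eq0.
Qed.

(** The difference of the two ordinates is affine, so a reversal of order forces its zero strictly
    between [x] and [x'], hence strictly inside both edges. *)
Lemma cross_sign_change e f x x' :
  X e.1.1 <= x <= X e.1.2 -> X f.1.1 <= x <= X f.1.2 ->
  X e.1.1 <= x' <= X e.1.2 -> X f.1.1 <= x' <= X f.1.2 ->
  ordinate f.2 x < ordinate e.2 x -> ordinate e.2 x' < ordinate f.2 x' ->
  cross e f.
Proof.
move=> /andP[ex1 ex2] /andP[fx1 fx2] /andP[ex1' ex2'] /andP[fx1' fx2'] fe ef.
have aN : a e.2 != a f.2.
  by apply: contraTneq ef => aE; move: fe; rewrite /ordinate aE -leNgt => fe; lra.
have := ordinate_sub x aN; have := ordinate_sub x' aN.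
rewrite /cross aN /spans /=; set z := abscissa_meet _ _ => h' h.
have {h'} h' : (a e.2 - a f.2) * (x' - z) < 0 by rewrite -h' subr_lt0.
have {h} h : 0 < (a e.2 - a f.2) * (x - z) by rewrite -h subr_gt0.
have [s|s|s] := ltgtP (a e.2 - a f.2) 0; last by move: aN; rewrite -subr_eq0 s eqxx.
  by move: h h'; rewrite nmulr_rgt0 // nmulr_rlt0 // => ? ?; lra.
by move: h h'; rewrite pmulr_rgt0 // pmulr_rlt0 // => ? ?; lra.
Qed.

Hypothesis pos_inj : forall u v, X u = X v -> Y u = Y v -> u = v.
Hypothesis line_inj : forall k l, a k = a l -> b k = b l -> k = l.

Lemma is_edge_lt e : is_edge e -> X e.1.1 < X e.1.2.
Proof. by case/and4P. Qed.

Lemma edge_left e : is_edge e -> Y e.1.1 = ordinate e.2 (X e.1.1).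
Proof. by case/and4P => _ /eqP. Qed.

Lemma edge_right e : is_edge e -> Y e.1.2 = ordinate e.2 (X e.1.2).
Proof. by case/and4P => _ _ /eqP. Qed.

Lemma edge_gap e w : is_edge e -> Y w = ordinate e.2 (X w) ->
  X e.1.1 < X w <= X e.1.2 -> w = e.1.2.
Proof.
move=> he hw /andP[h1]; rewrite le_eqVlt => /orP[/eqP h2|h2].
  by apply: pos_inj => //; rewrite hw h2 -edge_right.
case/and4P: he => _ _ _ /forallP/(_ w); rewrite /incident hw eqxx /= h1 h2.
by [].
Qed.

(** By [edge_gap], no end of one edge falls inside the other, so the half-open shadows of the edges
    of one line are disjoint. *)
Lemma edge_uniq e f x : is_edge e -> is_edge f -> e.2 = f.2 ->
  X e.1.1 < x <= X e.1.2 -> X f.1.1 < x <= X f.1.2 -> e = f.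
Proof.
wlog le_ef : e f / X e.1.2 <= X f.1.2.
  move=> ih he hf ef hx hx'; have [?|?] := leP (X e.1.2) (X f.1.2); first exact: ih.
  by apply/esym/ih => //; apply: ltW.
move=> he hf ef /andP[ex ex'] /andP[fx fx'].
have r_eq : e.1.2 = f.1.2.
  by apply: edge_gap => //; [rewrite -ef; exact: edge_right|rewrite (lt_le_trans fx)].
have l_eq : e.1.1 = f.1.1.
  have [le_l|gt_l] := leP (X e.1.1) (X f.1.1).
    move: le_l; rewrite le_eqVlt => /orP[/eqP h|h].
      by apply: pos_inj => //; rewrite !edge_left // ef h.
    have h3: f.1.1 = e.1.2.
      apply: edge_gap => //; first by rewrite ef edge_left.
      by rewrite h /= ltW // (lt_le_trans fx).
    by move: (is_edge_lt hf); rewrite -r_eq h3 ltxx.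
  have h3: e.1.1 = f.1.2.
    apply: edge_gap => //; first by rewrite -ef edge_left.
    by rewrite gt_l /= ltW // (lt_le_trans ex) // r_eq.
  by move: (is_edge_lt he); rewrite r_eq h3 ltxx.
by move: e f ef r_eq l_eq {le_ef he hf ex ex' fx fx'} => [[? ?] ?] [[? ?] ?] /= -> -> ->.
Qed.

(** * Linear bound for non-crossing edges, by charging edges to vertices *)

Section NonCrossing.
Variables (S : {set V * V * W}) (U : {set V}).
Hypothesis S_edge : forall e, e \in S -> is_edge e.
Hypothesis S_ends : forall e, e \in S -> (e.1.1 \in U) && (e.1.2 \in U).
Hypothesis S_noncross : forall e f, e \in S -> f \in S -> ~~ cross e f.

Definition next_edge e f : Prop :=
  [/\ f \in S, f.1.1 = e.1.1, a e.2 < a f.2 &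
      forall g, g \in S -> g.1.1 = e.1.1 -> ~~ (a e.2 < a g.2 < a f.2)].

(** The sector between the two edges, cut off at the nearer right end. It is closed on that side, so
    it contains this end and a first vertex always exists; the common source is excluded. *)
Definition in_wedge e f v : bool :=
  [&& X e.1.1 < X v, X v <= X e.1.2, X v <= X f.1.2 &
      ordinate e.2 (X v) <= Y v <= ordinate f.2 (X v)].

Definition first_in_wedge e f v : Prop :=
  [/\ v \in U, in_wedge e f v &
      forall w, w \in U -> in_wedge e f w -> X v <= X w].

Lemma ordinate_same_source e f x : e \in S -> f \in S -> f.1.1 = e.1.1 ->
  ordinate f.2 x - ordinate e.2 x = (a f.2 - a e.2) * (x - X e.1.1).
Proof.
move=> Se Sf fe; have := edge_left (S_edge Se); have := edge_left (S_edge Sf).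
by rewrite fe /ordinate => h1 h2; lra.
Qed.

(* An edge that enters the wedge at abscissa [X v] must start there (it can
   cross neither side), which the minimality of [v] forbids. *)
Lemma wedge_empty e e' f v : e \in S -> f \in S -> next_edge e e' ->
  first_in_wedge e e' v ->
  X f.1.1 < X v <= X f.1.2 -> ordinate f.2 (X v) < ordinate e'.2 (X v) ->
  ordinate e.2 (X v) < ordinate f.2 (X v) \/
    ordinate e.2 (X v) = ordinate f.2 (X v) /\ a f.2 < a e.2 ->
  False.
Proof.
move=> Se Sf [Se' e'e ae nxt] [Uv /and4P[v1 v2 v3 v4] vmin] /andP[f1 f2] fe' ef.
have noc g g' x x' : g \in S -> g' \in S ->
    X g.1.1 <= x <= X g.1.2 -> X g'.1.1 <= x <= X g'.1.2 ->
    X g.1.1 <= x' <= X g.1.2 -> X g'.1.1 <= x' <= X g'.1.2 ->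
    ordinate g'.2 x < ordinate g.2 x -> ordinate g.2 x' < ordinate g'.2 x' -> False.
  move=> Sg Sg' h1 h2 h3 h4 h5 h6; move: (S_noncross Sg Sg').
  by rewrite (cross_sign_change h1 h2 h3 h4 h5 h6).
have Xe' : X e'.1.1 = X e.1.1 by rewrite e'e.
(* [x0] is the leftmost abscissa above which the three edges all exist. Followed back from [X v] to
   [x0], [f] stays between [e] and [e'], since leaving would be a crossing. *)
pose x0 := Num.max (X e.1.1) (X f.1.1).
have x0v : x0 < X v by rewrite /x0 gt_max v1.
have ex0 : X e.1.1 <= x0 by rewrite /x0 le_max lexx.
have fx0 : X f.1.1 <= x0 by rewrite /x0 le_max lexx orbT.
have fe'0 : ordinate f.2 x0 <= ordinate e'.2 x0.
  rewrite leNgt; apply/negP => h.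
  by apply: (noc f e' x0 (X v)) => //; lra.
have ef0 : ordinate e.2 x0 <= ordinate f.2 x0.
  rewrite leNgt; apply/negP => h; case: ef => [ef|[ef aef]].
    by apply: (noc e f x0 (X v)) => //; lra.
  by move: h ef; rewrite /ordinate; nra.
have [fle|elf] := leP (X f.1.1) (X e.1.1); last first.
  have x0E : x0 = X f.1.1 by rewrite /x0 max_r // ltW.
  move: x0v fe'0 ef0; rewrite x0E -(edge_left (S_edge Sf)) => x0v fe'0 ef0.
  have /andP[Uf _] := S_ends Sf.
  have : in_wedge e e' f.1.1.
    by rewrite /in_wedge elf fe'0 ef0 !andbT /=; apply/andP; split; lra.
  by move/(vmin _ Uf); rewrite leNgt x0v.
(* Otherwise [f] is squeezed through the apex of the wedge; no vertex is interior to an edge, so [f]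
   starts there, with a slope that [next_edge] forbids. *)
have x0E : x0 = X e.1.1 by rewrite /x0 max_l.
have fu : Y e.1.1 = ordinate f.2 (X e.1.1).
  have eY := edge_left (S_edge Se); have := edge_left (S_edge Se').
  by rewrite e'e -x0E => e'Y; apply: le_anti; rewrite {1}eY {1}e'Y -x0E ef0.
have {}fle : X f.1.1 = X e.1.1.
  apply: le_anti; rewrite fle /= leNgt; apply/negP => h.
  have h2 : e.1.1 = f.1.2.
    by apply: edge_gap fu _; rewrite ?S_edge // h /=; lra.
  by move: v1 f2; rewrite h2; lra.
have fs : f.1.1 = e.1.1.
  by apply: pos_inj => //; rewrite fu (edge_left (S_edge Sf)) fle.
have h1 := ordinate_same_source (X v) Se Sf fs.
have h2 := ordinate_same_source (X v) Se Se' e'e.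
have aef : a e.2 < a f.2.
  case: ef => [ef|[ef aef]].
    move: h1; set d := X v - _ => h1; have d0 : 0 < d by rewrite /d; lra.
    by rewrite -subr_gt0 -(pmulr_lgt0 _ d0) -h1; lra.
  move: h1; set d := X v - _ => h1; have d0 : 0 < d by rewrite /d; lra.
  have : (a f.2 - a e.2) * d < 0 by rewrite nmulr_rlt0 //; lra.
  by rewrite -h1; lra.
have := nxt f Sf fs; rewrite aef /= => /negP; apply.
have d0 : 0 < X v - X e.1.1 by lra.
rewrite -subr_gt0 -(pmulr_lgt0 _ d0).
have -> : (a e'.2 - a f.2) * (X v - X e.1.1) = ordinate e'.2 (X v) - ordinate f.2 (X v).
  lra.
lra.
Qed.

Lemma exists_next e g : e \in S -> g \in S -> g.1.1 = e.1.1 -> a e.2 < a g.2 ->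
  exists f, next_edge e f.
Proof.
move=> Se Sg ge aeg.
pose P f := [&& f \in S, f.1.1 == e.1.1 & a e.2 < a f.2].
have Pg : P g by rewrite /P Sg ge eqxx aeg.
have [f /and3P[Sf /eqP fe af] fmin] := @arg_minP _ _ _ g P (fun f => a f.2) Pg.
exists f; split=> // h Sh he; apply/negP => /andP[ah hf].
by have := fmin h; rewrite /P Sh he eqxx ah leNgt hf => /(_ isT).
Qed.

Lemma next_above e f x : e \in S -> next_edge e f -> X e.1.1 < x ->
  ordinate e.2 x < ordinate f.2 x.
Proof.
move=> Se [Sf fe af _] x1; rewrite -subr_gt0 (ordinate_same_source _ Se Sf fe).
by rewrite mulr_gt0 // subr_gt0.
Qed.

Lemma exists_first e f : e \in S -> next_edge e f ->
  exists v, first_in_wedge e f v.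
Proof.
move=> Se nf; have [Sf fe _ _] := nf.
have [/andP[_ Ue] /andP[_ Uf]] := (S_ends Se, S_ends Sf).
have [eX fX] := (is_edge_lt (S_edge Se), is_edge_lt (S_edge Sf)).
have Xfe : X f.1.1 = X e.1.1 by rewrite fe.
pose P v := (v \in U) && in_wedge e f v.
have [v0 Pv0] : exists v, P v.
  have [le_ef|lt_fe] := leP (X e.1.2) (X f.1.2).
    exists e.1.2; rewrite /P Ue /in_wedge eX le_ef !lexx edge_right ?S_edge // lexx /=.
    exact/ltW/next_above.
  exists f.1.2; rewrite /P Uf /in_wedge -Xfe fX lexx (ltW lt_fe) edge_right ?S_edge // lexx /=.
  by rewrite andbT; apply/ltW/next_above => //; rewrite -Xfe.
have [v /andP[Uv wv] vmin] := @arg_minP _ _ _ v0 P X Pv0.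
by exists v; split=> // w Uw ww; apply: vmin; rewrite /P Uw.
Qed.

(** If the edges differ, the higher one at [X v] (on a tie, the one of smaller slope) enters the
    wedge of the other, against [wedge_empty]. The flag is needed because [v] may end the top side
    of one wedge and the bottom side of the next. *)
Lemma wedge_vertex_inj e e' f f' v : e \in S -> f \in S ->
  next_edge e e' -> next_edge f f' ->
  first_in_wedge e e' v -> first_in_wedge f f' v ->
  (ordinate e.2 (X v) < Y v) = (ordinate f.2 (X v) < Y v) -> e = f.
Proof.
move=> Se Sf ne nf fe ff same.
have [_ /and4P[e1 e2 e3 /andP[e4 e5]] _] := fe.
have [_ /and4P[f1 f2 f3 /andP[f4 f5]] _] := ff.
have ex := next_above Se ne e1; have fx := next_above Sf nf f1.
have [h|h|h] := ltgtP (ordinate e.2 (X v)) (ordinate f.2 (X v)).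
- exfalso; apply: (wedge_empty Se Sf ne fe); [by rewrite f1| |by left].
  have [s|s] := boolP (ordinate f.2 (X v) < Y v); first exact: lt_le_trans e5.
  by move: same; rewrite (negbTE s) (lt_le_trans h f4).
- exfalso; apply: (wedge_empty Sf Se nf ff); [by rewrite e1| |by left].
  have [s|s] := boolP (ordinate e.2 (X v) < Y v); first exact: lt_le_trans f5.
  by move: same; rewrite (negbTE s) (lt_le_trans h e4).
have [ha|ha|ha] := ltgtP (a e.2) (a f.2).
- by exfalso; apply: (wedge_empty Sf Se nf ff); [rewrite e1|rewrite h|right].
- by exfalso; apply: (wedge_empty Se Sf ne fe); [rewrite f1|rewrite -h|right].
apply: (@edge_uniq e f (X v)); rewrite ?S_edge ?e1 ?f1 //.
by apply: line_inj => //; move: h; rewrite /ordinate ha; lra.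
Qed.

(* An edge that is not the steepest one at its left end [u] is charged to the
   leftmost vertex between it and the next steeper edge at [u]. *)
Lemma noncrossing_card : (#|S| <= 3 * #|U|)%N.
Proof.
(* [T] holds the steepest edges, at most one per left end; [N s] holds the others, split by the flag
   of [wedge_vertex_inj]. Each of the three sets injects into [U]. *)
pose T := [set e in S | [forall g in S, (g.1.1 == e.1.1) ==> ~~ (a e.2 < a g.2)]].
pose N s := [set e in S | `[< exists f v, [/\ next_edge e f, first_in_wedge e f v &
  (ordinate e.2 (X v) < Y v) = s] >]].
have -> : (3 * #|U| = #|U| + #|U| + #|U|)%N by lia.
apply: (@leq_trans (#|T| + #|N true| + #|N false|)).
  apply: (@leq_trans (#|T :|: N true :|: N false|)); last first.
    by rewrite (leq_trans (leq_card_setU _ _)) // leq_add2r leq_card_setU.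
  apply/subset_leq_card/fintype.subsetP => e Se; rewrite !inE Se /=.
  case: (boolP [forall g in S, _]) => //=; rewrite negb_forall_in => /exists_inP[g Sg].
  rewrite negb_imply negbK => /andP[/eqP ge ag].
  have [f nf] := exists_next Se Sg ge ag; have [v fv] := exists_first Se nf.
  apply/orP; case s : (ordinate e.2 (X v) < Y v); [left|right]; apply/asboolP;
    by exists f, v.
have leN s : (#|N s| <= #|U|)%N.
  apply: (@leq_card_rel _ _ _ _ (fun e v => exists f, [/\ next_edge e f,
    first_in_wedge e f v & (ordinate e.2 (X v) < Y v) = s])).
    move=> e; rewrite inE => /andP[Se /asboolP[f [v [nf fv sv]]]].
    by exists v; [case: fv|exists f].
  move=> e e' v; rewrite !inE => /andP[Se _] /andP[Se' _].
  move=> [f [nf fv sv]] [f' [nf' fv' sv']].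
  by apply: (wedge_vertex_inj Se Se' nf nf' fv fv'); rewrite sv sv'.
rewrite !leq_add //.
apply: (@leq_card_rel _ _ _ _ (fun e u => e.1.1 = u)).
  move=> e; rewrite inE => /andP[Se _]; exists e.1.1 => //.
  by have /andP[] := S_ends Se.
move=> e f u; rewrite !inE => /andP[Se /forall_inP he] /andP[Sf /forall_inP hf] eu fu.
have ef : f.1.1 = e.1.1 by rewrite eu fu.
have := he f Sf; have := hf e Se; rewrite ef !eqxx /= -!leNgt => h1 h2.
have aE : a e.2 = a f.2 by apply: le_anti; rewrite h1 h2.
have Xe := is_edge_lt (S_edge Se); have Xf := is_edge_lt (S_edge Sf).
have l_eq : e.2 = f.2.
  apply: line_inj => //; have := edge_left (S_edge Se); rewrite -ef (edge_left (S_edge Sf)).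
  by rewrite /ordinate aE => /addrI.
apply: (@edge_uniq e f (Num.min (X e.1.2) (X f.1.2))); rewrite ?S_edge //.
  by rewrite lt_min Xe -ef Xf ge_min lexx.
by rewrite lt_min Xf ef Xe ge_min lexx orbT.
Qed.

End NonCrossing.
(** Edges that cross nothing obey the linear bound; every other edge is the first member of some
    crossing pair. *)
Lemma card_edges_le (S : {set V * V * W}) (U : {set V}) :
  (forall e, e \in S -> is_edge e) ->
  (forall e, e \in S -> (e.1.1 \in U) && (e.1.2 \in U)) ->
  (#|S| <= 3 * #|U| + #|[set p in finset.setX S S | cross p.1 p.2]|)%N.
Proof.
move=> S_edge S_ends.
pose S0 := [set e in S | [forall f in S, ~~ cross e f]].
have S0S : S0 \subset S by apply/fintype.subsetP => e; rewrite inE => /andP[].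
rewrite -(cardsID S0 S) leq_add //.
  have -> : S :&: S0 = S0 by apply/finset.setIidPr.
  apply: noncrossing_card => [e|e|e f]; rewrite !inE.
  - by case/andP => /S_edge.
  - by case/andP => /S_ends.
  - by move=> /andP[_ /forall_inP h] /andP[Sf _]; exact: h.
apply: (@leq_card_rel _ _ _ _ (fun e p => p.1 = e)).
  move=> e; rewrite !inE => /andP[nS0 Se]; move: nS0; rewrite Se /=.
  rewrite negb_forall_in => /exists_inP[f Sf]; rewrite negbK => cr.
  by exists (e, f) => //; rewrite !inE /= Se Sf.
by move=> e f p _ _ -> ->.
Qed.

Definition crossing_edges : {set (V * V * W) * (V * V * W)} :=
  [set p | [&& is_edge p.1, is_edge p.2 & cross p.1 p.2]].

(** Two lines meet at one abscissa, and on each of them only one edge spans it, so the pair of lines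
    determines the pair of edges. *)
Lemma card_crossing_edges : (#|crossing_edges| <= #|W| ^ 2)%N.
Proof.
rewrite -mulnn -card_prod -cardsT.
apply: (@leq_card_rel _ _ _ _ (fun p q => q = (p.1.2, p.2.2))).
  by move=> p _; exists (p.1.2, p.2.2).
move=> [e f] [e' f'] q; rewrite !inE /= => /and3P[he hf] /and3P[_ ce cf].
move=> /and3P[he' hf'] /and3P[_ ce' cf'] -> [ee' ff'].
by congr (_, _); [apply: (@edge_uniq _ _ (abscissa_meet e.2 f.2))
  |apply: (@edge_uniq _ _ (abscissa_meet e.2 f.2))] => //; rewrite ?ee' ?ff';
  move: ce cf ce' cf'; rewrite /spans ?ee' ?ff' => /andP[? ?] /andP[? ?] /andP[? ?] /andP[? ?];
  lra.
Qed.

(** An incidence that is not leftmost on its line is the right end of an edge from the nearest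
    predecessor; the leftmost ones number at most one per line. *)
Lemma card_incidences_le :
  (#|[set p : V * W | incident p.1 p.2]| <= #|[set e | is_edge e]| + #|W|)%N.
Proof.
set I := [set p : V * W | incident p.1 p.2].
pose F := [set p in I | [exists w, incident w p.2 && (X w < X p.1)]].
have FI : F \subset I by apply/fintype.subsetP => e; rewrite inE => /andP[].
rewrite -(cardsID F I) leq_add //.
  have -> : I :&: F = F by apply/finset.setIidPr.
  apply: (@leq_card_rel _ _ _ _ (fun p e => p = (e.1.2, e.2))); last first.
    by move=> p q e _ _ -> ->.
  move=> [v l]; rewrite !inE /= => /andP[iv /existsP[w0 Pw0]].
  have [w /andP[iw wv] wmax] :=
    @arg_maxP _ _ _ w0 (fun w => incident w l && (X w < X v)) X Pw0.
  exists (w, v, l) => //; rewrite inE /is_edge /= wv iw iv /=.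
  apply/forallP => u; apply/implyP => iu; apply/negP => /andP[wu uv].
  have : X u <= X w by apply: wmax; rewrite iu.
  by rewrite leNgt wu.
rewrite -cardsT; apply: (@leq_card_rel _ _ _ _ (fun p l => p.2 = l)).
  by move=> p _; exists p.2.
move=> [v l] [v' l'] k; rewrite !inE /= => /andP[h iv] /andP[h' iv'] lk lk'.
move: lk' h' iv'; rewrite -{k}lk => {l'}-> h' iv'; move: h h'; rewrite iv iv' /=.
rewrite !negb_exists => /forallP/(_ v') h /forallP/(_ v) h'.
move: h h'; rewrite iv iv' /= -!leNgt => h h'.
have XE : X v = X v' by apply: le_anti; rewrite h h'.
congr (_, _); apply: pos_inj => //.
by move: iv iv'; rewrite /incident => /eqP -> /eqP ->; rewrite XE.
Qed.

End PlanarGraph.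

(** * Averages over vertex colourings *)

Section RandomColouring.
Context {V : finType} (m : nat).

Definition monochromatic (f : {ffun V -> 'I_m}) (c : 'I_m) (T : {set V}) : bool :=
  [forall x in T, f x == c].

Lemma card_monochromatic c (T : {set V}) :
  (#|[set f | monochromatic f c T]| * m ^ #|T| = m ^ #|V|)%N.
Proof.
pose F x : pred 'I_m := if x \in T then pred1 c else predT.
have -> : #|[set f | monochromatic f c T]| = #|family F|.
  apply: eq_card => f; rewrite !inE; apply/forall_inP/familyP => h x.
    by rewrite /F; case: ifP => // /h.
  by move=> xT; have := h x; rewrite /F xT.
rewrite card_family foldrE big_map big_enum /=.
rewrite -[#|V|](cardC (mem T)) expnD.
rewrite (bigID (mem T)) /= big1 ?mul1n => [|x xT]; last by rewrite /F xT card1.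
rewrite (eq_bigr (fun=> m)) => [|x xT]; last by rewrite /F (negbTE xT) card_ord.
rewrite prod_nat_const mulnC; congr (_ ^ _ * _ ^ _)%N; exact: eq_card.
Qed.

(* Averaged over the colourings, each element of [A] is monochromatic with
   probability [m ^ (1 - k)]. *)
Lemma sum_monochromatic (Q : finType) (A : {set Q}) (supp : Q -> {set V}) k :
  (forall q, q \in A -> #|supp q| = k) ->
  ((\sum_(f : {ffun V -> 'I_m}) \sum_(c < m)
      #|[set q in A | monochromatic f c (supp q)]|) * m ^ k =
    #|A| * m ^ #|V|.+1)%N.
Proof.
move=> suppA.
have -> : (\sum_(f : {ffun V -> 'I_m}) \sum_(c < m)
    #|[set q in A | monochromatic f c (supp q)]| =
  \sum_(q in A) \sum_(c < m) #|[set f | monochromatic f c (supp q)]|)%N.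
  transitivity (\sum_(f : {ffun V -> 'I_m}) \sum_(c < m) \sum_(q in A)
      monochromatic f c (supp q))%N.
    do 2![apply: eq_bigr => ? _]; rewrite -sum1_card big_mkcond [RHS]big_mkcond /=.
    by apply: eq_bigr => q _; rewrite !inE; case: (q \in A) => //=; case: monochromatic.
  rewrite (eq_bigr _ (fun f _ => exchange_big _ _ _ _ _ _)) /=.
  rewrite exchange_big; apply: eq_bigr => q _ /=.
  rewrite exchange_big; apply: eq_bigr => c _ /=.
  by rewrite -sum1_card [RHS]big_mkcond; apply: eq_bigr => f _; rewrite inE; case: monochromatic.
rewrite big_distrl /= -sum_nat_const; apply: eq_bigr => q Aq.
rewrite big_distrl /= -(suppA q Aq).
under eq_bigr => c _ do rewrite card_monochromatic.
by rewrite sum_nat_const card_ord expnS.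
Qed.

End RandomColouring.

(** * Crossing lemma and incidence bound with a free parameter *)

Section SzemerediTrotter.
Context {R : realFieldType} {V W : finType} (X Y : V -> R) (a b : W -> R).
Hypothesis pos_inj : forall u v, X u = X v -> Y u = Y v -> u = v.
Hypothesis line_inj : forall k l, a k = a l -> b k = b l -> k = l.

Let edges := [set e | is_edge X Y a b e].
Let crossings := crossing_edges X Y a b.
Let ends (e : V * V * W) := [set e.1.1; e.1.2].

Lemma card_ends e : e \in edges -> #|ends e| = 2%N.
Proof.
rewrite inE => /is_edge_lt lt_e; rewrite cards2; suff -> : e.1.1 != e.1.2 by [].
by apply: contraTneq lt_e => ->; rewrite ltxx.
Qed.

(** A common end would lie on both lines, hence at their meeting point, which is strictly inside
    each edge. *)
Lemma card_ends_cross p : p \in crossings -> #|ends p.1 :|: ends p.2| = 4%N.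
Proof.
case: p => e f; rewrite inE /= => /and3P[he hf /and3P[aN /andP[se1 se2] /andP[sf1 sf2]]].
have [Ee Ef] : e \in edges /\ f \in edges by rewrite !inE.
rewrite cardsU !card_ends //; suff -> : ends e :&: ends f = finset.set0 by rewrite cards0.
apply/setP => v; rewrite finset.in_set0; apply/negbTE/negP; rewrite finset.in_setI => /andP[ve vf].
have Ye : Y v = ordinate a b e.2 (X v).
  by move: ve; rewrite !inE => /orP[] /eqP ->; [exact: edge_left|exact: edge_right].
have Yf : Y v = ordinate a b f.2 (X v).
  by move: vf; rewrite !inE => /orP[] /eqP ->; [exact: edge_left|exact: edge_right].
have := ordinate_sub b (X v) aN; rewrite -Ye -Yf subrr => /esym/eqP.
rewrite mulf_eq0 !subr_eq0 (negbTE aN) /= => /eqP XE.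
by move: ve se1 se2; rewrite -XE !inE => /orP[] /eqP ->; rewrite ltxx.
Qed.

(** Apply [card_edges_le] inside every colour class and average over the colourings: an edge is
    monochromatic with probability 1/m, a crossing pair with probability 1/m^3, and each vertex lies
    in one class. Multiply by m^3. *)
Lemma crossing_lemma (m : nat) : (0 < m)%N ->
  (#|edges| * m ^ 2 <= 3 * #|V| * m ^ 3 + #|crossings|)%N.
Proof.
move=> m0.
have s2 := sum_monochromatic m card_ends.
have s4 := sum_monochromatic m card_ends_cross.
have s1 := @sum_monochromatic V m V [set: V] (fun v => [set v]) 1 (fun v _ => cards1 v).
rewrite -(@leq_pmul2r (m ^ #|V|.+1)) ?expn_gt0 ?m0 // mulnDl -s4.
have -> : (#|edges| * m ^ 2 * m ^ #|V|.+1 = #|edges| * m ^ #|V|.+1 * m ^ 2)%N by lia.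
have -> : (3 * #|V| * m ^ 3 * m ^ #|V|.+1 = 3 * (#|V| * m ^ #|V|.+1) * m ^ 3)%N by lia.
rewrite cardsT in s1; rewrite -s2 -s1 -mulnA -expnD.
rewrite mulnA -[in X in (_ <= X + _)%N]mulnA -expnD -mulnDl leq_mul2r; apply/orP; right.
rewrite big_distrr /= -big_split /=; apply: leq_sum => f _.
rewrite big_distrr /= -big_split /=; apply: leq_sum => c _.
have monoE e : monochromatic f c (ends e) = (f e.1.1 == c) && (f e.1.2 == c).
  apply/forall_inP/andP => [h|[h1 h2] x]; first by rewrite !h ?inE ?eqxx ?orbT.
  by rewrite !inE => /orP[] /eqP ->.
pose U := [set v | f v == c].
apply: (leq_trans (@card_edges_le _ _ _ X Y a b pos_inj line_inj _ U _ _)).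
- by move=> e; rewrite !inE => /andP[].
- by move=> e; rewrite !inE monoE => /andP[].
apply: leq_add; last first.
  apply/subset_leq_card/fintype.subsetP => -[e e']; rewrite !inE /= !monoE.
  move=> /andP[/andP[/andP[-> /andP[h1 h2]] /andP[-> /andP[h3 h4]]] ->] /=.
  by apply/forall_inP => x; rewrite !inE => /orP[] /orP[] /eqP ->.
rewrite leq_mul2l /=; apply/subset_leq_card/fintype.subsetP => v; rewrite !inE => fv.
by apply/forall_inP => x; rewrite inE => /eqP ->.
Qed.

(** Taking [m] of order (|W|^2 / |V|)^(1/3) would give the classical exponents. *)
Lemma szemeredi_trotter_full (m : nat) : (0 < m)%N ->
  (#|[set p : V * W | incident X Y a b p.1 p.2]| * m ^ 2 <=
    #|W| * m ^ 2 + #|W| ^ 2 + 3 * #|V| * m ^ 3)%N.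
Proof.
move=> m0; have := @card_crossing_edges _ _ _ X Y a b pos_inj.
have := @card_incidences_le _ _ _ X Y a b pos_inj; have := crossing_lemma m0.
rewrite -/edges -/crossings => h1 h2 h3.
by apply: (leq_trans (leq_mul h2 (leqnn _))); rewrite mulnDl; lia.
Qed.

End SzemerediTrotter.

Lemma szemeredi_trotter {R : realFieldType} {V W : finType} (P : {set V}) (L : {set W})
    (X Y : V -> R) (a b : W -> R) (m : nat) : (0 < m)%N ->
  {in P &, forall u v, X u = X v -> Y u = Y v -> u = v} ->
  {in L &, forall k l, a k = a l -> b k = b l -> k = l} ->
  (#|[set p | [&& p.1 \in P, p.2 \in L & incident X Y a b p.1 p.2]]| * m ^ 2 <=
    #|L| * m ^ 2 + #|L| ^ 2 + 3 * #|P| * m ^ 3)%N.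
Proof.
move=> m0 Pinj Linj.
have := @szemeredi_trotter_full R {v | v \in P} {l | l \in L}
  (X \o val) (Y \o val) (a \o val) (b \o val) _ _ m m0.
rewrite !card_sig => h; apply: (leq_trans _ (h _ _)).
- rewrite leq_mul2r; apply/orP; right.
  apply: (@leq_card_rel _ _ _ _ (fun p q => p = (val q.1, val q.2))); last first.
    by move=> p q r _ _ -> ->.
  move=> [v l]; rewrite inE /= => /and3P[Pv Ll i].
  by exists (Sub v Pv, Sub l Ll) => //; rewrite inE.
- by move=> u v /= h1 h2; apply/val_inj/Pinj => //; exact: valP.
- by move=> u v /= h1 h2; apply/val_inj/Linj => //; exact: valP.
Qed.

(** * Orthogonal directions *)

Lemma card_le_sum_cover (T Q : finType) (A : {set T}) (F : Q -> {set T}) :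
  (forall x, x \in A -> exists q, x \in F q) -> (#|A| <= \sum_q #|F q|)%N.
Proof.
move=> AF; have -> : (\sum_q #|F q| = \sum_q \sum_x (x \in F q))%N.
  by apply: eq_bigr => q _; rewrite -sum1_card big_mkcond; apply: eq_bigr => x _; case: (x \in _).
rewrite exchange_big -sum1_card big_mkcond /=; apply: leq_sum => x _.
case: ifP => // /AF[q xFq]; by rewrite (bigD1 q) //= xFq.
Qed.

Lemma third_coordinate (i j : 'I_3) : i != j ->
  exists k : 'I_3, [/\ k != i, k != j & forall x, [|| x == i, x == j | x == k]].
Proof.
move=> ij; have := ltn_ord i; have := ltn_ord j => j3 i3.
have nij : (i : nat) <> j by move/val_inj => h; rewrite h eqxx in ij.
(* The three indices 0, 1, 2 sum to 3. *)
have kE : (inord (3 - i - j) : 'I_3) = (3 - i - j)%N :> nat by rewrite inordK //; lia.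
exists (inord (3 - i - j)); rewrite -!val_eqE /= kE; split; [lia|lia|move=> x].
by rewrite -!val_eqE /= kE; have := ltn_ord x; lia.
Qed.

Section Vectors.
Context {R : realType}.
Implicit Types u v w : 'rV[R]_3.

Lemma dot_coordinates (i j k : 'I_3) u v : i != j -> k != i -> k != j ->
  dot u v = u 0 i * v 0 i + u 0 j * v 0 j + u 0 k * v 0 k.
Proof.
move=> ij ki kj; rewrite /dot (bigD1 i) //= (bigD1 j) 1?eq_sym //=.
rewrite (bigD1 k) ?ki ?kj //= big1 ?addr0 ?addrA // => x /andP[/andP[xi xj] xk].
have nE (p q : 'I_3) : p != q -> (p : nat) <> q by apply: contra_neq_not => /val_inj.
exfalso; move: (nE _ _ ij) (nE _ _ ki) (nE _ _ kj) (nE _ _ xi) (nE _ _ xj) (nE _ _ xk).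
by move: (ltn_ord i) (ltn_ord j) (ltn_ord k) (ltn_ord x); lia.
Qed.

(* Central projection of the directions from the coordinate plane [x_i = 1]
   turns orthogonality into point-line incidence. *)
Lemma card_orthogonal_coordinates (T : finType) (d : T -> 'rV[R]_3) (A B : {set T})
    (i j : 'I_3) (m : nat) : (0 < m)%N -> i != j ->
  (forall s, s \in A -> d s 0 i != 0) -> (forall t, t \in B -> d t 0 j != 0) ->
  {in A &, forall s t c, d s = c *: d t -> s = t} ->
  {in B &, forall s t c, d s = c *: d t -> s = t} ->
  (#|[set p : T * T | [&& p.1 \in A, p.2 \in B & dot (d p.1) (d p.2) == 0%R]]| * m ^ 2 <=
    #|B| * m ^ 2 + #|B| ^ 2 + 3 * #|A| * m ^ 3)%N.
Proof.
move=> m0 ij Ai Bj Ainj Binj; have [k [ki kj ijk]] := third_coordinate ij.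
(* Orthogonality divided by [d s 0 i * d t 0 j] and solved for [Y s]: the line of [t] is not
   vertical because [d t 0 j] is nonzero. *)
pose X s := d s 0 k / d s 0 i; pose Y s := d s 0 j / d s 0 i.
pose a t := - (d t 0 k / d t 0 j); pose b t := - (d t 0 i / d t 0 j).
have prop s t l l' : d s 0 l != 0 -> d t 0 l != 0 ->
    d s 0 l' / d s 0 l = d t 0 l' / d t 0 l -> d s 0 l' = d s 0 l / d t 0 l * d t 0 l'.
  by move=> s0 t0 /(congr1 ( *%R (d s 0 l))); rewrite mulrC divfK // => ->; field.
apply: (leq_trans _ (@szemeredi_trotter _ _ _ A B X Y a b m m0 _ _)).
- rewrite leq_mul2r; apply/orP; right; apply/subset_leq_card/fintype.subsetP => -[s t].
  rewrite !inE /= => /and3P[As Bt]; rewrite As Bt (dot_coordinates _ _ ij ki kj) => /eqP st.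
  have si := Ai s As; have tj := Bj t Bt.
  rewrite /incident /ordinate /X /Y /a /b /= -subr_eq0; apply/eqP.
  transitivity ((d s 0 i * d t 0 i + d s 0 j * d t 0 j + d s 0 k * d t 0 k) / (d s 0 i * d t 0 j)).
    by field; rewrite si tj.
  by rewrite st mul0r.
- move=> s t As At hX hY; have [si ti] := (Ai s As, Ai t At).
  apply: (Ainj s t As At (d s 0 i / d t 0 i)); apply/rowP => x; rewrite mxE.
  have /or3P[] := ijk x => /eqP ->; [by rewrite divfK|exact: prop|exact: prop].
move=> s t Bs Bt /oppr_inj hX /oppr_inj hY; have [sj tj] := (Bj s Bs, Bj t Bt).
apply: (Binj s t Bs Bt (d s 0 j / d t 0 j)); apply/rowP => x; rewrite mxE.
have /or3P[] := ijk x => /eqP ->; [exact: prop|by rewrite divfK|exact: prop].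
Qed.

(** Two nonzero orthogonal vectors have nonzero entries at two different indices, since otherwise
    both would be multiples of one basis vector. The 9 counts pairs of indices. *)
Lemma card_orthogonal (T : finType) (d : T -> 'rV[R]_3) (A B : {set T}) (m : nat) :
  (0 < m)%N ->
  (forall s, s \in A -> d s != 0) -> (forall t, t \in B -> d t != 0) ->
  {in A &, forall s t c, d s = c *: d t -> s = t} ->
  {in B &, forall s t c, d s = c *: d t -> s = t} ->
  (#|[set p : T * T | [&& p.1 \in A, p.2 \in B & dot (d p.1) (d p.2) == 0%R]]| * m ^ 2 <=
    9 * (#|B| * m ^ 2 + #|B| ^ 2 + 3 * #|A| * m ^ 3))%N.
Proof.
move=> m0 A0 B0 Ainj Binj.
pose C (D : {set T}) i := [set s in D | d s 0 i != 0].
have CD D i : C D i \subset D by apply/fintype.subsetP => s; rewrite inE => /andP[].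
pose F (q : 'I_3 * 'I_3) := [set p : T * T | [&& q.1 != q.2, p.1 \in C A q.1,
  p.2 \in C B q.2 & dot (d p.1) (d p.2) == 0%R]].
have cover : (#|[set p : T * T | [&& p.1 \in A, p.2 \in B & dot (d p.1) (d p.2) == 0%R]]|
    <= \sum_q #|F q|)%N.
  apply: card_le_sum_cover => -[s t]; rewrite inE /= => /and3P[As Bt /eqP st].
  have /rV0Pn[i si] := A0 s As; have [/existsP[j /andP[ij tj]]|] :=
    boolP [exists j, (i != j) && (d t 0 j != 0)].
    by exists (i, j); rewrite !inE /= ij As si Bt tj st eqxx.
  rewrite negb_exists => /forallP h; exfalso.
  have t0 j : i != j -> d t 0 j = 0.
    by move=> ij; have := h j; rewrite ij negbK => /eqP.
  have ti : d t 0 i != 0.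
    have /rV0Pn[j tj] := B0 t Bt; have [->//|ij] := eqVneq i j.
    by rewrite t0 ?eqxx in tj.
  move: st; rewrite /dot (bigD1 i) //= big1 ?addr0 => [/eqP|j ji].
    by rewrite mulf_eq0 (negbTE si) (negbTE ti).
  by rewrite t0 ?mulr0 // eq_sym.
apply: (leq_trans (leq_mul cover (leqnn _))); rewrite big_distrl /=.
apply: (@leq_trans (\sum_(q : 'I_3 * 'I_3) (#|B| * m ^ 2 + #|B| ^ 2 + 3 * #|A| * m ^ 3)))%N; last first.
  by rewrite sum_nat_const card_prod card_ord.
apply: leq_sum => -[i j] _; have [ij|ij] := boolP (i != j); last first.
  by rewrite (_ : F _ = finset.set0) ?cards0 //; apply/setP => p; rewrite !inE /= (negbTE ij).
apply: (@leq_trans (#|C B j| * m ^ 2 + #|C B j| ^ 2 + 3 * #|C A i| * m ^ 3)%N); last first.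
  rewrite !leq_add ?leq_mul ?leq_exp2r ?subset_leq_card //.
apply: (leq_trans _ (@card_orthogonal_coordinates T d (C A i) (C B j) i j m m0 ij _ _ _ _)).
- rewrite leq_mul2r; apply/orP; right; apply/subset_leq_card/fintype.subsetP => p.
  by rewrite !inE /= => /and4P[_ -> -> ->].
- by move=> s; rewrite inE => /andP[].
- by move=> s; rewrite inE => /andP[].
- by move=> s t /(fintype.subsetP (CD _ _)) As /(fintype.subsetP (CD _ _)); exact: Ainj.
- by move=> s t /(fintype.subsetP (CD _ _)) As /(fintype.subsetP (CD _ _)); exact: Binj.
Qed.

End Vectors.

Lemma exists_notin (R : realFieldType) (s : seq R) : exists t : R, t \notin s.
Proof.
exists (1 + \sum_(x <- s) `|x|); apply/negP => h.
have : 1 + \sum_(x <- s) `|x| <= \sum_(x <- s) `|x|.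
  by rewrite [leRHS](big_rem _ h) /=; apply: ler_wpDr; [exact: sumr_ge0|exact: ler_norm].
by lra.
Qed.

(** Two distinct pairs collide for at most one [t], so finitely many values must be avoided. *)
Lemma exists_generic_slope (R : realFieldType) (s : seq (R * R)) :
  exists t : R, {in s &, forall p q, p.1 + t * p.2 = q.1 + t * q.2 -> p = q}.
Proof.
have [t tN] := exists_notin [seq (q.1 - p.1) / (p.2 - q.2) | p <- s, q <- s].
exists t => p q ps qs h; have [e2|n2] := eqVneq p.2 q.2.
  by move: h; rewrite e2 => /addIr e1; rewrite [p]surjective_pairing e1 e2 -surjective_pairing.
exfalso; move/negP: tN; apply; apply/allpairsP; exists (p, q); split=> //=.
by apply: canRL (mulfK _) _; [rewrite subr_eq0|lra].
Qed.

(** * Lines spanned by a point set *)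

Section Lines.
Context {R : realType} {V : finType} (pos : V -> 'rV[R]_3).
Hypothesis pos_inj : injective pos.
Implicit Types (q u v x y z : V) (l : {set V}).

(** A line is represented by its trace on the point set; for distinct [q] and [y] the trace has two
    points and so determines the line. *)
Definition line_through q y : {set V} :=
  [set z | `[< exists c, pos z - pos q = c *: (pos y - pos q) >]].

Definition lines : {set {set V}} :=
  [set line_through p.1 p.2 | p in [set p : V * V | p.1 != p.2]].

Definition rich_lines (k : nat) : {set {set V}} := [set l in lines | (k <= #|l|)%N].

Definition rich_incidences (k : nat) : nat := (\sum_(l in rich_lines k) #|l|)%N.

Lemma line_throughP q y z :
  reflect (exists c, pos z - pos q = c *: (pos y - pos q)) (z \in line_through q y).
Proof. by rewrite inE; exact: asboolP. Qed.

Lemma mem_line_left q y : q \in line_through q y.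
Proof. by apply/line_throughP; exists 0; rewrite scale0r subrr. Qed.

Lemma mem_line_right q y : y \in line_through q y.
Proof. by apply/line_throughP; exists 1; rewrite scale1r. Qed.

Lemma line_through_eq q y u v : u \in line_through q y -> v \in line_through q y ->
  u != v -> line_through u v = line_through q y.
Proof.
move=> /line_throughP[c uE] /line_throughP[e vE] uv; set D := pos y - pos q in uE vE.
have vuE : pos v - pos u = (e - c) *: D by rewrite scalerBl -uE -vE opprB addrA subrK.
have ec : e - c != 0.
  apply: contraNneq uv => ec; move: vuE; rewrite ec scale0r => /eqP.
  by rewrite subr_eq0 => /eqP/pos_inj ->.
apply/setP => z; apply/line_throughP/line_throughP => -[r zE].
  exists (r * (e - c) + c); rewrite -/D scalerDl -scalerA -vuE -zE -uE.
  by rewrite addrA subrK.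
exists ((r - c) / (e - c)); rewrite vuE scalerA divfK // scalerBl -/D in zE *.
by rewrite -zE -uE opprB addrA subrK.
Qed.

Lemma line_through_lines q y : q != y -> line_through q y \in lines.
Proof. by move=> qy; apply/imsetP; exists (q, y); rewrite ?inE. Qed.

Lemma linesP l : l \in lines -> exists q y, [/\ q != y, q \in l, y \in l & l = line_through q y].
Proof.
move=> /imsetP[[q y]]; rewrite inE /= => qy ->.
by exists q, y; rewrite mem_line_left mem_line_right.
Qed.

Lemma lines_eq l u v : l \in lines -> u \in l -> v \in l -> u != v -> l = line_through u v.
Proof. by move=> /linesP[q [y [qy _ _ ->]]] ul vl uv; rewrite (line_through_eq ul vl uv). Qed.

Lemma lines_card_ge2 l : l \in lines -> (1 < #|l|)%N.
Proof.
move=> /linesP[q [y [qy ql yl _]]].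
by rewrite (cardsD1 q) ql (cardsD1 y) !inE eq_sym qy yl.
Qed.

(** Distinct lines through [q] share no other point, and removing [q] leaves at least half of each
    line, whence the 2. *)
Lemma card_rich_lines_through q k :
  (#|[set l in rich_lines k | q \in l]| * k <= 2 * #|V|)%N.
Proof.
set A := [set l in rich_lines k | q \in l].
pose T := [set p : {set V} * V | [&& p.1 \in A, p.2 \in p.1 & p.2 != q]].
have TV : (#|T| <= #|V|)%N.
  rewrite -cardsT; apply: (@leq_card_rel _ _ _ _ (fun p y => p.2 = y)).
    by move=> p _; exists p.2.
  move=> [l y] [l' y'] z; rewrite !inE /= => /and3P[/andP[/andP[hl _] ql] yl yq].
  move=> /and3P[/andP[/andP[hl' _] ql'] yl' y'q] yz y'z; rewrite -yz in y'z.
  by rewrite y'z (lines_eq hl ql yl) 1?eq_sym // -y'z -(lines_eq hl' ql' yl') // eq_sym.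
have TE : (#|T| = \sum_(l in A) #|l :\ q|)%N.
  rewrite -sum1_card (eq_bigl (fun p : {set V} * V => (p.1 \in A) && (p.2 \in p.1 :\ q))).
    rewrite -(pair_big_dep (mem A) (fun l y => y \in l :\ q) (fun _ _ => 1%N)) /=.
    by apply: eq_bigr => l _; rewrite sum1_card.
  by move=> p; rewrite !inE; congr (_ && _); exact: andbC.
apply: leq_trans (leq_mul (leqnn 2) TV); rewrite TE big_distrr /= -sum_nat_const.
apply: leq_sum => l; rewrite !inE => /andP[/andP[hl kl] ql].
by have := lines_card_ge2 hl; rewrite (cardsD1 q) ql /= in kl *; lia.
Qed.

Lemma sum_card_rich_lines_through k :
  (\sum_q #|[set l in rich_lines k | q \in l]| = rich_incidences k)%N.
Proof.
rewrite /rich_incidences; under eq_bigr => q _ do rewrite -sum1_card big_mkcond.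
rewrite exchange_big [RHS]big_mkcond; apply: eq_bigr => l _ /=.
under eq_bigr => q _ do rewrite inE.
case: (l \in rich_lines k) => /=; last by rewrite big1.
by rewrite -sum1_card [RHS]big_mkcond.
Qed.

Lemma card_rich_lines_le k : (#|rich_lines k| * k <= rich_incidences k)%N.
Proof.
rewrite -sum_nat_const; apply: leq_sum => l; by rewrite inE => /andP[].
Qed.

(** An ordered pair of distinct points lies on one line only, and a line has at least as many such
    pairs as points. *)
Lemma rich_incidences_trivial k : (rich_incidences k <= #|V| ^ 2)%N.
Proof.
pose T := [set p : {set V} * (V * V) | [&& p.1 \in rich_lines k, p.2.1 \in p.1,
  p.2.2 \in p.1 & p.2.1 != p.2.2]].
have TV : (#|T| <= #|V| ^ 2)%N.
  rewrite -mulnn -card_prod -[#|{: V * V}|]cardsT.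
  apply: (@leq_card_rel _ _ _ _ (fun p r => p.2 = r)).
    by move=> p _; exists p.2.
  move=> [l p] [l' p'] r; rewrite !inE /= => /and4P[/andP[hl _] ul vl uv].
  move=> /and4P[/andP[hl' _] ul' vl' _] pr pr'; move: pr' ul' vl'; rewrite -{r}pr => -> ul' vl'.
  by rewrite (lines_eq hl ul vl uv) -(lines_eq hl' ul' vl' uv).
apply: leq_trans TV; rewrite -sum1_card.
rewrite (eq_bigl (fun p : {set V} * (V * V) => (p.1 \in rich_lines k) &&
  (p.2 \in [set r : V * V | [&& r.1 \in p.1, r.2 \in p.1 & r.1 != r.2]]))); last first.
  by move=> p; rewrite !inE.
rewrite -(pair_big_dep (mem (rich_lines k)) (fun l r => r \in
  [set r : V * V | [&& r.1 \in l, r.2 \in l & r.1 != r.2]]) (fun _ _ => 1%N)) /=.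
apply: leq_sum => l; rewrite inE => /andP[/linesP[q [y [qy ql yl _]]] _]; rewrite sum1_card.
apply: (@leq_card_rel _ _ _ _ (fun u r => r = if u == q then (u, y) else (u, q))).
  move=> u ul; exists (if u == q then (u, y) else (u, q)) => //.
  by case: eqVneq => [->|uq]; rewrite !inE /= ?ql ?yl ?ul.
by move=> u v r _ _ -> /(congr1 fst); case: ifP => _; case: ifP.
Qed.

(* Projecting along a generic direction of the plane [x_i = 0] keeps points
   and lines distinct. *)
Lemma incidences_transversal (L : {set {set V}}) (i : 'I_3) (m : nat) : (0 < m)%N ->
  (forall l, l \in L -> exists q y, [/\ q != y, l = line_through q y & pos q 0 i != pos y 0 i]) ->
  (#|[set p : V * {set V} | (p.2 \in L) && (p.1 \in p.2)]| * m ^ 2 <=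
    #|L| * m ^ 2 + #|L| ^ 2 + 3 * #|V| * m ^ 3)%N.
Proof.
move=> m0 Li.
have [j ij] : exists j : 'I_3, i != j.
  have [->|i0] := eqVneq i 0; first by exists 1.
  by exists 0.
have [k [ki kj ijk]] := third_coordinate ij.
have [L0|[l0 Ll0]] := set_0Vmem L.
  rewrite (_ : [set p | _] = finset.set0) ?cards0 //.
  by apply/setP => p; rewrite !inE L0 inE.
have [q0 [y0 _]] := Li l0 Ll0.
pose r l := odflt (q0, y0) [pick p |
  (l == line_through p.1 p.2) && (pos p.1 0 i != pos p.2 0 i)].
have rP l : l \in L ->
    l = line_through (r l).1 (r l).2 /\ pos (r l).2 0 i - pos (r l).1 0 i != 0.
  move=> /Li[q [y [_ lE qy]]]; rewrite /r; case: pickP => [p /andP[/eqP lp ip]|].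
    by rewrite subr_eq0 eq_sym.
  by move=> /(_ (q, y)); rewrite -lE eqxx qy.
(* On [l] the coordinate [s] is the affine function of slope [al s l] and intercept [be s l] of the
   coordinate [i]. *)
pose D l s := pos (r l).2 0 s - pos (r l).1 0 s.
pose al s l := D l s / D l i; pose be s l := pos (r l).1 0 s - al s l * pos (r l).1 0 i.
have memE l v : l \in L -> v \in l <-> forall s, pos v 0 s = al s l * pos v 0 i + be s l.
  move=> Ll; have [lE Di] := rP l Ll; rewrite {1}lE; split.
    move=> /line_throughP[c /rowP h] s; have := h s; have := h i; rewrite !mxE.
    rewrite -/(D l s) -/(D l i) /be /al => hi hs.
    have -> : pos v 0 s = c * D l s + pos (r l).1 0 s by rewrite -hs subrK.
    have -> : pos v 0 i = c * D l i + pos (r l).1 0 i by rewrite -hi subrK.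
    by field.
  move=> h; apply/line_throughP; exists ((pos v 0 i - pos (r l).1 0 i) / D l i).
  apply/rowP => s; rewrite !mxE -/(D l s) (h s) /be /al; field.
  exact: Di.
(* A single [t] must keep apart the points, the slopes and the intercepts. *)
pose S := [seq (pos v 0 j, pos v 0 k) | v <- enum V] ++
  [seq (al j l, al k l) | l <- enum L] ++ [seq (be j l, be k l) | l <- enum L].
have [t tP] := exists_generic_slope S.
have SV v : (pos v 0 j, pos v 0 k) \in S.
  by rewrite mem_cat (map_f (fun v => (pos v 0 j, pos v 0 k))) ?mem_enum.
have Sal l : l \in L -> (al j l, al k l) \in S.
  by move=> Ll; rewrite !mem_cat (map_f (fun l => (al j l, al k l))) ?mem_enum ?orbT.
have Sbe l : l \in L -> (be j l, be k l) \in S.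
  by move=> Ll; rewrite !mem_cat (map_f (fun l => (be j l, be k l))) ?mem_enum ?orbT.
pose X v := pos v 0 i; pose Y v := pos v 0 j + t * pos v 0 k.
pose a l := al j l + t * al k l; pose b l := be j l + t * be k l.
rewrite -[#|V|]cardsT.
apply: (leq_trans _ (@szemeredi_trotter _ _ _ [set: V] L X Y a b m m0 _ _)).
- rewrite leq_mul2r; apply/orP; right; apply/subset_leq_card/fintype.subsetP => -[v l].
  rewrite !inE /= => /andP[Ll vl]; rewrite Ll /incident /ordinate /X /Y /a /b.
  have [h _] := memE l v Ll; rewrite (h vl j) (h vl k); apply/eqP; ring.
- move=> u v _ _ XE /(tP _ _ (SV u) (SV v))[jE kE]; apply/pos_inj/rowP => s.
  by have /or3P[] := ijk s => /eqP ->.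
move=> l l' Ll Ll' /(tP _ _ (Sal _ Ll) (Sal _ Ll'))[aj ak].
move=> /(tP _ _ (Sbe _ Ll) (Sbe _ Ll'))[bj bk].
have same s : al s l = al s l' /\ be s l = be s l'.
  have /or3P[] := ijk s => /eqP -> //; have [_ Di] := rP l Ll; have [_ Di'] := rP l' Ll'.
  by rewrite /be /al !divff // !mul1r !subrr.
apply/setP => v; apply/idP/idP => /memE h; apply/memE => // s.
  by have [<- <-] := same s; apply: h.
by have [-> ->] := same s; apply: h.
Qed.

(** Each line varies in one of the three coordinates, and [incidences_transversal] applies to each
    class; hence the 3. *)
Lemma rich_incidences_st k m : (0 < m)%N ->
  (rich_incidences k * m ^ 2 <=
    3 * (#|rich_lines k| * m ^ 2 + #|rich_lines k| ^ 2 + 3 * #|V| * m ^ 3))%N.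
Proof.
move=> m0; set L := rich_lines k.
have -> : rich_incidences k = #|[set p : V * {set V} | (p.2 \in L) && (p.1 \in p.2)]|.
  rewrite -sum1_card; under eq_bigl => p do rewrite inE.
  rewrite -(pair_big_dep xpredT (fun v l => (l \in L) && (v \in l)) (fun _ _ => 1%N)) /=.
  rewrite (exchange_big_dep (mem L)) /= => [|v l _ /andP[]//].
  rewrite /rich_incidences; apply: eq_bigr => l Ll.
  by rewrite -sum1_card; apply: eq_bigl => v; rewrite -/L Ll.
pose Li i := [set l in L | [exists p : V * V, [&& p.1 != p.2, l == line_through p.1 p.2 &
  pos p.1 0 i != pos p.2 0 i]]].
pose F i := [set p : V * {set V} | (p.2 \in Li i) && (p.1 \in p.2)].
have cover : (#|[set p : V * {set V} | (p.2 \in L) && (p.1 \in p.2)]| <= \sum_i #|F i|)%N.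
  apply: card_le_sum_cover => -[v l]; rewrite inE /= => /andP[Ll vl].
  have := Ll; rewrite inE => /andP[/linesP[q [y [qy _ _ lE]]] _].
  have [/existsP[i qi]|] := boolP [exists i, pos q 0 i != pos y 0 i].
    by exists i; rewrite finset.in_set /= vl andbT finset.in_set Ll; apply/existsP; exists (q, y); rewrite qy lE eqxx.
  rewrite negb_exists => /forallP h; exfalso; move/eqP: qy; apply; apply/pos_inj/rowP => i.
  by have := h i; rewrite negbK => /eqP.
apply: (leq_trans (leq_mul cover (leqnn _))); rewrite big_distrl /=.
apply: (@leq_trans (\sum_(i < 3) (#|L| * m ^ 2 + #|L| ^ 2 + 3 * #|V| * m ^ 3)))%N; last first.
  by rewrite sum_nat_const card_ord.
apply: leq_sum => i _.
have LiL : Li i \subset L by apply/fintype.subsetP => l; rewrite inE => /andP[].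
apply: (@leq_trans (#|Li i| * m ^ 2 + #|Li i| ^ 2 + 3 * #|V| * m ^ 3)%N).
  apply: incidences_transversal m0 _ => l; rewrite inE => /andP[_ /existsP[[q y] /and3P[qy /eqP lE iE]]].
  by exists q, y; split; [exact: qy|exact: lE|exact: iE].
by rewrite !leq_add ?leq_mul ?leq_exp2r ?subset_leq_card.
Qed.

End Lines.

(** * Counting right angles *)

Section Dot.
Context {R : realType} {d : nat}.
Implicit Types u v w : 'rV[R]_d.

Lemma dotC u v : dot u v = dot v u.
Proof. by apply: eq_bigr => i _; rewrite mulrC. Qed.

Lemma dotBl u v w : dot (u - v) w = dot u w - dot v w.
Proof. by rewrite -sumrB; apply: eq_bigr => i _; rewrite !mxE mulrBl. Qed.

Lemma dotZl c u v : dot (c *: u) v = c * dot u v.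
Proof. by rewrite mulr_sumr; apply: eq_bigr => i _; rewrite mxE mulrA. Qed.

Lemma dotBr u v w : dot w (u - v) = dot w u - dot w v.
Proof. by rewrite !(dotC w) dotBl. Qed.

Lemma dotZr c u v : dot u (c *: v) = c * dot u v.
Proof. by rewrite !(dotC u) dotZl. Qed.

Lemma dot_ge0 u : 0 <= dot u u.
Proof. by apply: sumr_ge0 => i _; rewrite -expr2 sqr_ge0. Qed.

Lemma dot_eq0 u : dot u u = 0 -> u = 0.
Proof.
move=> /eqP; rewrite psumr_eq0 => [/allP h|i _]; last by rewrite -expr2 sqr_ge0.
apply/rowP => i; have := h i (mem_index_enum i); rewrite mulf_eq0 orbb mxE.
by move=> /eqP.
Qed.
End Dot.

Section RightAngles.
Context {R : realType} {V : finType} (pos : V -> 'rV[R]_3).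
Hypothesis pos_inj : injective pos.
Implicit Types (q x y z : V) (l : {set V}).

Let J := rich_incidences pos.
Let n := #|V|.

Lemma rich_incidences_le k : (J k * k ^ 2 <= 54 * 1024 * (n ^ 2 + n * k ^ 2))%N.
Proof.
have [k6|k6] := ltnP k 6.
  have h : (J k <= n ^ 2)%N := rich_incidences_trivial pos_inj k.
  have k25 : (k ^ 2 <= 25)%N by rewrite (@leq_exp2r k 5 2).
  apply: (leq_trans (leq_mul h k25)); move: (n ^ 2)%N (n * k ^ 2)%N => u v; lia.
have := card_rich_lines_le pos k; rewrite -/J; set L := #|rich_lines pos k| => LJ.
(* The least such [m] makes the quadratic term absorbable: 24 L^2 <= J m^2. As k >= 6 also gives 6 L
   <= J, the terms in L take up at most 5/8 of J m^2, which leaves J <= 24 n m. *)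
have [m0 m0P] : exists m, (0 < m)%N && (24 * L <= m ^ 2 * k)%N.
  exists (24 * L).+1; rewrite /=; nia.
have ex : exists m, (0 < m)%N && (24 * L <= m ^ 2 * k)%N by exists m0.
case: (ex_minnP ex) => m /andP[m_gt0 mP] mmin.
have := rich_incidences_st pos_inj k m_gt0; rewrite -/J -/L -/n => st.
have Jm : (J k <= 24 * n * m)%N.
  have h1 : (6 * (L * m ^ 2) <= J k * m ^ 2)%N by rewrite mulnA leq_mul2r mulnC; apply/orP; right; nia.
  have h2 : (24 * L ^ 2 <= J k * m ^ 2)%N.
    rewrite -(@leq_pmul2r k) ?(leq_trans _ k6) //.
    have : (24 * L * (L * k) <= m ^ 2 * k * J k)%N by exact: leq_mul.
    by lia.
  rewrite -(@leq_pmul2r (m ^ 2)) ?expn_gt0 ?m_gt0 //.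
  have -> : (24 * n * m * m ^ 2 = 24 * (n * m ^ 3))%N by lia.
  by move: st h1 h2; set z := (n * m ^ 3)%N; lia.
have [m1|m1] := leqP m 1.
  have : (J k <= 24 * n)%N by apply: (leq_trans Jm); nia.
  by move=> h; apply: (leq_trans (leq_mul h (leqnn _))); lia.
(* Minimality makes this choice tight up to the factor 4 lost between m - 1 and m. The final
   constant is 54 * 1024 = 24^2 * 96. *)
have mk : (m ^ 2 * k <= 96 * L)%N.
  have : ~~ ((0 < m.-1)%N && (24 * L <= m.-1 ^ 2 * k)%N).
    by apply/negP => /mmin; lia.
  have -> /= : (0 < m.-1)%N by lia.
  rewrite -ltnNge => h.
  have : (m ^ 2 <= 4 * m.-1 ^ 2)%N by case: m m1 {mP mmin st Jm h m_gt0} => [|[|m]] //= _; nia.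
  by move=> h'; have := leq_mul h' (leqnn k); lia.
have [J0|J0] := posnP (J k); first by rewrite J0 mul0n.
suff : (J k * k ^ 2 <= 54 * 1024 * n ^ 2)%N by lia.
rewrite -(@leq_pmul2r (J k)) //.
have h1 : (J k * J k * k ^ 2 <= (24 * n * m) * (24 * n * m) * k ^ 2)%N by rewrite !leq_mul.
have h2 : ((24 * n) ^ 2 * k * (m ^ 2 * k) <= (24 * n) ^ 2 * k * (96 * L))%N by rewrite leq_mul2l mk orbT.
have h3 : ((24 * n) ^ 2 * 96 * (L * k) <= (24 * n) ^ 2 * 96 * J k)%N by rewrite leq_mul2l LJ orbT.
by lia.
Qed.

Definition perp x q y : bool :=
  [&& x != q, y != q & dot (pos x - pos q) (pos y - pos q) == 0].

Definition right_angles : {set V * V * V} := [set t | perp t.1.1 t.1.2 t.2].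

Lemma perpC x q y : perp x q y = perp y q x.
Proof. by rewrite /perp dotC andbCA. Qed.

(* The vertex of a right angle is the foot of the perpendicular dropped from
   [x] onto the other side. *)
Lemma card_rich_right_angles k :
  (#|[set t in right_angles | k <= #|line_through pos t.1.2 t.2|]| <= n * J k)%N.
Proof.
pose T := [set p : {set V} * V | (p.1 \in rich_lines pos k) && (p.2 \in p.1)].
have -> : (n * J k = #|finset.setX [set: V] T|)%N.
  rewrite cardsX cardsT; congr (_ * _)%N; rewrite -sum1_card.
  under eq_bigl => p do rewrite inE.
  rewrite -(pair_big_dep (mem (rich_lines pos k)) (fun l z => z \in l) (fun _ _ => 1%N)) /=.
  by apply: eq_bigr => l _; rewrite sum1_card.
apply: (@leq_card_rel _ _ _ _ (fun t s => s = (t.1.1, (line_through pos t.1.2 t.2, t.2)))).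
  move=> [[x q] y]; rewrite !inE /= => /andP[/and3P[xq yq _] kl].
  exists (x, (line_through pos q y, y)) => //.
  rewrite finset.in_setX finset.in_setT finset.in_set /= mem_line_right andbT finset.in_set kl.
  by rewrite line_through_lines // eq_sym.
move=> [[x q] y] [[x' q'] y'] s; rewrite !inE /= => /andP[/and3P[xq yq /eqP h] _].
move=> /andP[/and3P[xq' yq' /eqP h'] _] -> [xE lE yE]; subst x' y'.
suff -> : q = q' by [].
have : q \in line_through pos q' y by rewrite -lE mem_line_left.
have : q' \in line_through pos q y by rewrite lE mem_line_left.
move=> /line_throughP[c cE] /line_throughP[e eE].
apply/pos_inj/eqP; rewrite -subr_eq0; apply/eqP/dot_eq0.
have h1 : dot (pos x - pos q) (pos q' - pos q) = 0 by rewrite cE dotZr h mulr0.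
have h2 : dot (pos x - pos q') (pos q - pos q') = 0 by rewrite eE dotZr h' mulr0.
move: h1 h2; rewrite !(dotBl, dotBr) (dotC (pos q') (pos q)); lra.
Qed.

(** A vector along [l], based at [q]; different lines through [q] receive non-proportional
    vectors. *)
Definition direction q l : 'rV[R]_3 :=
  pos (odflt q [pick y in l | y != q]) - pos q.

Lemma directionP q l : l \in lines pos -> q \in l ->
  exists2 z, z \in l & z != q /\ direction q l = pos z - pos q.
Proof.
move=> Ll ql; rewrite /direction; case: pickP => [z /andP[zl zq]|h]; first by exists z.
have : (0 < #|l :\ q|)%N by have := lines_card_ge2 Ll; rewrite (cardsD1 q) ql.
by move=> /card_gt0P[z]; rewrite !inE andbC h.
Qed.

Lemma direction_neq0 q l : l \in lines pos -> q \in l -> direction q l != 0.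
Proof.
move=> Ll ql; have [z _ [zq ->]] := directionP Ll ql.
by rewrite subr_eq0 (inj_eq pos_inj).
Qed.

Lemma direction_inj q l l' c : l \in lines pos -> q \in l -> l' \in lines pos -> q \in l' ->
  direction q l = c *: direction q l' -> l = l'.
Proof.
move=> Ll ql Ll' ql'; have [z zl [zq ->]] := directionP Ll ql.
have [z' zl' [zq' ->]] := directionP Ll' ql' => h.
have zz' : z \in l' by rewrite (lines_eq pos_inj Ll' ql' zl') 1?eq_sym //; apply/line_throughP; exists c.
by rewrite (lines_eq pos_inj Ll ql zl) 1?eq_sym // -(lines_eq pos_inj Ll' ql' zz') // eq_sym.
Qed.

Lemma direction_line_through q x : x != q ->
  exists c, direction q (line_through pos q x) = c *: (pos x - pos q).
Proof.
move=> xq; have := @directionP q (line_through pos q x).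
rewrite mem_line_left line_through_lines 1?eq_sym // => /(_ isT isT)[z zl [_ ->]].
exact/line_throughP.
Qed.

Definition right_angles_between (A B : nat) : {set V * V * V} :=
  [set t in right_angles | (A <= #|line_through pos t.1.2 t.1.1| < 8 * A)%N &&
    (B <= #|line_through pos t.1.2 t.2| < 8 * B)%N].

(** Here 576 = 9 * 64: the 9 comes from [card_orthogonal], and each orthogonal pair of lines carries
    at most 8A * 8B pairs of end points. *)
Lemma card_right_angles_between_at q A B m : (0 < m)%N ->
  (#|[set t in right_angles_between A B | t.1.2 == q]| * m ^ 2 <= 576 * A * B *
    (#|[set l in rich_lines pos B | q \in l]| * m ^ 2 +
     #|[set l in rich_lines pos B | q \in l]| ^ 2 +
     3 * #|[set l in rich_lines pos A | q \in l]| * m ^ 3))%N.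
Proof.
move=> m0; pose N k := [set l in rich_lines pos k | q \in l].
pose N' k := [set l in N k | (#|l| < 8 * k)%N].
have N'N k : N' k \subset N k by apply/fintype.subsetP => l; rewrite inE => /andP[].
have N'P k l : l \in N' k -> l \in lines pos /\ q \in l.
  by rewrite !inE => /andP[/andP[/andP[]]].
pose O := [set p : {set V} * {set V} | [&& p.1 \in N' A, p.2 \in N' B &
  dot (direction q p.1) (direction q p.2) == 0%R]].
have hO : (#|O| * m ^ 2 <= 9 * (#|N B| * m ^ 2 + #|N B| ^ 2 + 3 * #|N A| * m ^ 3))%N.
  apply: (@leq_trans (9 * (#|N' B| * m ^ 2 + #|N' B| ^ 2 + 3 * #|N' A| * m ^ 3))%N).
    apply: card_orthogonal m0 _ _ _ _.
    - by move=> l /N'P[? ?]; exact: direction_neq0.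
    - by move=> l /N'P[? ?]; exact: direction_neq0.
    - by move=> l l' /N'P[? ?] /N'P[? ?] c; exact: direction_inj.
    - by move=> l l' /N'P[? ?] /N'P[? ?] c; exact: direction_inj.
  by rewrite leq_mul2l /= !leq_add ?leq_mul ?leq_exp2r ?subset_leq_card.
pose F (p : {set V} * {set V}) := [set t : V * V * V |
  [&& p \in O, t.1.1 \in p.1, t.1.2 == q & t.2 \in p.2]].
have cover : (#|[set t in right_angles_between A B | t.1.2 == q]| <= \sum_p #|F p|)%N.
  apply: card_le_sum_cover => -[[x q'] y]; rewrite inE /= => /andP[+ /eqP qE].
  rewrite {q'}qE !inE /= => /andP[/and3P[xq yq /eqP xy] /andP[/andP[x1 x2] /andP[y1 y2]]].
  have [c cE] := direction_line_through xq; have [e eE] := direction_line_through yq.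
  have o : dot (direction q (line_through pos q x)) (direction q (line_through pos q y)) == 0.
    by rewrite cE eE dotZl dotZr xy !mulr0.
  move: (@line_through_lines _ _ pos q x) (@line_through_lines _ _ pos q y) o x1 x2 y1 y2 {cE eE}.
  move: (mem_line_left pos q x) (mem_line_right pos q x) (mem_line_left pos q y) (mem_line_right pos q y).
  rewrite ![q == _]eq_sym; move: (line_through pos q x) (line_through pos q y) => l l'.
  move=> ql xl ql' yl' /(_ xq) Ll /(_ yq) Ll' o x1 x2 y1 y2.
  by exists (l, l'); rewrite !inE /= Ll Ll' ql xl ql' yl' o x1 x2 y1 y2 eqxx.
have hF : (\sum_p #|F p| <= #|O| * (64 * A * B))%N.
  rewrite -sum_nat_const [leqRHS]big_mkcond /=; apply: leq_sum => -[l l'] _.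
  case: ifPn => [Ol|nO]; last first.
    by rewrite (_ : F _ = finset.set0) ?cards0 //; apply/setP => t; rewrite finset.in_set (negbTE nO) inE.
  have /and3P[h h' _] : [&& l \in N' A, l' \in N' B & dot (direction q l) (direction q l') == 0].
    by move: Ol; rewrite inE.
  have lA : (#|l| <= 8 * A)%N by move: h; rewrite inE => /andP[_ /ltnW].
  have lB : (#|l'| <= 8 * B)%N by move: h'; rewrite inE => /andP[_ /ltnW].
  apply: (@leq_trans #|finset.setX l l'|); last by rewrite cardsX; apply: (leq_trans (leq_mul lA lB)); lia.
  apply: (@leq_card_rel _ _ _ _ (fun t s => s = (t.1.1, t.2))).
    by move=> [[x q'] y]; rewrite inE => /and4P[_ /= hx _ hy]; exists (x, y); rewrite // inE /= hx.
  move=> [[x q'] y] [[x' q''] y'] s; rewrite !inE => /and4P[_ _ /eqP /= -> _].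
  by move=> /and4P[_ _ /eqP /= -> _] -> [-> ->].
apply: (leq_trans (leq_mul (leq_trans cover hF) (leqnn _))).
rewrite -/(N A) -/(N B); move: hO.
set Z := (#|N B| * m ^ 2 + _ + _)%N => hO.
have := leq_mul (leqnn (64 * A * B)) hO; lia.
Qed.

(** Summed over the vertex [q], the linear terms become incidences; one factor of the quadratic term
    is first bounded by 2n / B, and the extra [B] on both sides clears that denominator. *)
Lemma card_right_angles_between A B m : (0 < m)%N ->
  (#|right_angles_between A B| * (B * m ^ 2) <= 576 * A * B *
    (J B * (B * m ^ 2) + 2 * n * J B + 3 * J A * (B * m ^ 3)))%N.
Proof.
move=> m0; set T := right_angles_between A B.
have TE : (#|T| = \sum_q #|[set t in T | t.1.2 == q]|)%N.
  rewrite -sum1_card (partition_big (fun t : V * V * V => t.1.2) xpredT) //=.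
  by apply: eq_bigr => q _; rewrite -sum1_card; apply: eq_bigl => t; rewrite inE.
pose N k q := #|[set l in rich_lines pos k | q \in l]|.
have JE k : J k = (\sum_q N k q)%N by rewrite sum_card_rich_lines_through.
have N2 : (\sum_q N B q ^ 2 * B <= 2 * n * J B)%N.
  rewrite JE big_distrr /=; apply: leq_sum => q _.
  have : (N B q * B <= 2 * n)%N := card_rich_lines_through pos_inj q B.
  by move=> h; have := leq_mul h (leqnn (N B q)); lia.
apply: (@leq_trans (576 * A * B *
  (J B * (B * m ^ 2) + \sum_q N B q ^ 2 * B + 3 * J A * (B * m ^ 3))))%N; last first.
  by rewrite leq_mul2l !leq_add ?orbT.
rewrite TE !JE !(big_distrl, big_distrr) /= -big_split /= ?big_distrl.
rewrite -big_split big_distrr /=; apply: leq_sum => q _.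
have h := card_right_angles_between_at q A B m0.
have := leq_mul h (leqnn B); rewrite -/(N A q) -/(N B q) -/T.
by move: (#|_|) (N B q) (N A q) => x y z; lia.
Qed.

End RightAngles.

(* Here [x = 2 ^ b], [y = 2 ^ (a - b)] and [z = 2 ^ (t - 3 a)]. *)
Lemma balance_classes (x y z n D JA JB T : nat) :
  (0 < x)%N -> (0 < y)%N -> (0 < z)%N -> (n <= (x ^ 3 * y ^ 3 * z) ^ 3)%N ->
  (JA * ((x * y) ^ 3) ^ 2 <= D)%N -> (JB * (x ^ 3) ^ 2 <= D)%N ->
  (T * (x ^ 3 * (x ^ 2 * y ^ 5 * z) ^ 2) <= 576 * (x * y) ^ 3 * x ^ 3 *
    (JB * (x ^ 3 * (x ^ 2 * y ^ 5 * z) ^ 2) + 2 * n * JB +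
     3 * JA * (x ^ 3 * (x ^ 2 * y ^ 5 * z) ^ 3)))%N ->
  (T <= 576 * D * (y ^ 3 + 5 * (x ^ 2 * y ^ 2 * z)))%N.
Proof.
move=> x0 y0 z0 hn hA hB h.
rewrite -(@leq_pmul2r (x ^ 13 * y ^ 13 * z ^ 2)) ?muln_gt0 ?expn_gt0 ?x0 ?y0 ?z0 //.
(* This factor makes [JB * x ^ 6] or [JA * (x * y) ^ 6] appear in each term, ready for [hB] and
   [hA]. The last two terms become equal monomials with coefficients 2 and 3, whence the 5. *)
have := leq_mul h (leqnn (x ^ 6 * y ^ 3)).
have -> : (T * (x ^ 3 * (x ^ 2 * y ^ 5 * z) ^ 2) * (x ^ 6 * y ^ 3) =
  T * (x ^ 13 * y ^ 13 * z ^ 2))%N by ring.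
move/leq_trans; apply.
have h1 := leq_mul hB (leqnn (x ^ 13 * y ^ 16 * z ^ 2)).
have h2 := leq_mul (leq_mul hB hn) (leqnn (2 * (x * y) ^ 6)).
have h3 := leq_mul hA (leqnn (3 * (x ^ 15 * y ^ 15 * z ^ 3))).
set Z := (D * _)%N in h1; set Z' := (D * _ * _)%N in h2; set Z'' := (D * _)%N in h3.
have -> : (576 * D * (y ^ 3 + 5 * (x ^ 2 * y ^ 2 * z)) * (x ^ 13 * y ^ 13 * z ^ 2) =
  576 * (Z + Z' + Z''))%N by rewrite /Z /Z' /Z''; ring.
apply: leq_trans (_ : _ <= 576 * (_ + _ + _))%N _; last first.
  by rewrite leq_mul2l; apply: leq_add (leq_add h1 h2) h3.
by apply: eq_leq; ring.
Qed.

Lemma sum_pow8 k : (\sum_(i < k.+1) 8 ^ i <= 2 * 8 ^ k)%N.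
Proof.
elim: k => [|k ih]; first by rewrite big_ord1.
by rewrite big_ord_recr /= expnS; move: ih; move: (\sum_(_ < _) _)%N (8 ^ k)%N => u v; lia.
Qed.

Lemma sum_arith_geom N t : (N <= t.+1)%N ->
  (\sum_(a < N) a.+1 * 2 ^ (t - a) + (N + 2) * 2 ^ (t.+1 - N) = 4 * 2 ^ t)%N.
Proof.
elim: N => [|N ih] Nt; first by rewrite big_ord0 subn0 expnS; lia.
rewrite big_ord_recr /= -(ih (ltnW Nt)) (subSn (_ : N <= t)%N) // expnS subSS.
by move: (\sum_(_ < _) _)%N (2 ^ (t - N))%N => v u; lia.
Qed.

(** * Summation over classes of line sizes *)

Section DyadicCount.
Context {R : realType} {V : finType} (pos : V -> 'rV[R]_3).
Hypothesis pos_inj : injective pos.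
Implicit Types (q x y z : V) (l : {set V}).

Let J := rich_incidences pos.
Let n := #|V|.

Lemma rich_incidences_small k : (k ^ 2 <= 8 * n)%N ->
  (J k * k ^ 2 <= 54 * 1024 * 9 * n ^ 2)%N.
Proof.
move=> kn; apply: (leq_trans (rich_incidences_le pos_inj k)); rewrite -/n.
have := leq_mul (leqnn n) kn; move: (n * k ^ 2)%N => z.
have -> : (n * (8 * n) = 8 * n ^ 2)%N by rewrite -mulnn; lia.
move: (n ^ 2)%N => u; lia.
Qed.

(* The sampling rate [m] balances the two nonlinear terms of the incidence
   bound up to a factor decaying geometrically in [a]. *)
Lemma card_right_angles_dyadic a b t : (b <= a)%N -> (3 * a <= t)%N ->
  (n <= 8 ^ t)%N -> (8 ^ t <= 8 * n)%N ->
  (#|right_angles_between pos (8 ^ a) (8 ^ b)| <=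
    576 * (54 * 1024 * 9 * n ^ 2) * (8 ^ (a - b) + 5 * 2 ^ (t - a)))%N.
Proof.
move=> ba at_ nt tn; set D := (54 * 1024 * 9 * n ^ 2)%N.
have p8 i : (8 ^ i = (2 ^ i) ^ 3)%N by rewrite -expnM mulnC expnM.
have JD k : (k <= a)%N -> (J (8 ^ k) * (8 ^ k) ^ 2 <= D)%N.
  move=> ka; apply: rich_incidences_small; apply: leq_trans tn.
  rewrite p8 -!expnM p8 -expnM leq_exp2l //; lia.
have JA := JD a (leqnn _); have JB := JD b ba; move: JA JB {JD}.
have [c aE] : exists c, (a = b + c)%N by exists (a - b)%N; lia.
have [e tE] : exists e, (t = 3 * b + 3 * c + e)%N by exists (t - 3 * a)%N; lia.
have -> : (a - b = c)%N by lia.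
have -> : (t - a = 2 * b + 2 * c + e)%N by lia.
have pM i k : (2 ^ (i * k) = (2 ^ k) ^ i)%N by rewrite mulnC expnM.
have Ea : (8 ^ a = (2 ^ b * 2 ^ c) ^ 3)%N by rewrite p8 aE expnD.
have Et : (8 ^ t = ((2 ^ b) ^ 3 * (2 ^ c) ^ 3 * 2 ^ e) ^ 3)%N by rewrite p8 tE 2!expnD !pM.
have Ee : (2 ^ (2 * b + 2 * c + e) = (2 ^ b) ^ 2 * (2 ^ c) ^ 2 * 2 ^ e)%N by rewrite 2!expnD !pM.
have m0 : (0 < (2 ^ b) ^ 2 * (2 ^ c) ^ 5 * 2 ^ e)%N by rewrite !muln_gt0 !expn_gt0.
have := card_right_angles_between pos_inj (8 ^ a) (8 ^ b) m0.
rewrite -/J -/n Ee (p8 c) => main hA hB; move: nt hA hB main.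
rewrite Et Ea (p8 b); apply: balance_classes; by rewrite expn_gt0.
Qed.

Lemma card_poor_right_angles t : (n <= 8 ^ t)%N -> (8 ^ t <= 8 * n)%N ->
  (#|[set u in right_angles pos | (#|line_through pos u.1.2 u.2| <=
      #|line_through pos u.1.2 u.1.1| < 2 ^ t)%N]| <=
    576 * (54 * 1024 * 9 * n ^ 2) * (24 * 2 ^ t))%N.
Proof.
move=> nt tn; set D := (54 * 1024 * 9 * n ^ 2)%N; pose T := (t %/ 3)%N.
(* The index stops at [t %/ 3] because 8^a <= 2^t means 3a <= t. *)
pose F (p : 'I_T.+1 * 'I_T.+1) :=
  if (p.2 <= p.1)%N then right_angles_between pos (8 ^ p.1) (8 ^ p.2) else finset.set0.
have T3 a : (a <= T)%N -> (3 * a <= t)%N by rewrite /T; lia.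
apply: (@leq_trans (\sum_p #|F p|)).
  apply: card_le_sum_cover => -[[x q] y]; rewrite finset.in_set /= => /andP[ra /andP[yx xt]].
  set k := #|line_through pos q x| in yx xt; set r := #|line_through pos q y| in yx.
  have r0 : (0 < r)%N by apply/card_gt0P; exists q; exact: mem_line_left.
  have k0 : (0 < k)%N by exact: leq_trans yx.
  have aT : (trunc_log 8 k < T.+1)%N.
    have : (8 ^ trunc_log 8 k < 2 ^ t)%N by apply: leq_ltn_trans xt; exact: trunc_logP.
    by rewrite (_ : 8 = 2 ^ 3)%N // -expnM ltn_exp2l // /T; lia.
  have ba : (trunc_log 8 r <= trunc_log 8 k)%N by exact: leq_trunc_log.
  exists (Ordinal aT, Ordinal (leq_ltn_trans ba aT)).
  rewrite /F /= ba finset.in_set ra /= -/k -/r -!expnS.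
  by rewrite !trunc_logP // !trunc_log_ltn.
apply: (@leq_trans (\sum_(a < T.+1) \sum_(b < a.+1) 576 * D * (8 ^ (a - b) + 5 * 2 ^ (t - a)))%N).
  rewrite -(pair_bigA _ (fun a b => #|F (a, b)|)) /=; apply: leq_sum => a _.
  rewrite (big_ord_widen T.+1 (fun b => 576 * D * (8 ^ (a - b) + 5 * 2 ^ (t - a)))%N) ?ltn_ord //.
  rewrite [leqRHS]big_mkcond /=; apply: leq_sum => b _; rewrite /F /= ltnS.
  case: ifP => [ba|_]; last by rewrite cards0.
  by apply: card_right_angles_dyadic => //; apply: T3; rewrite -ltnS.
under eq_bigr => a _ do rewrite -big_distrr /= big_split /= sum_nat_const card_ord.
rewrite -big_distrr leq_mul2l; apply/orP; right => /=.
(* The factor [a.+1] counts the classes b <= a. The two sums are at most 4 * 2^t and 5 * 4 * 2^t,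
   which makes 24. *)
apply: (@leq_trans (\sum_(a < T.+1) (2 * 8 ^ a + 5 * (a.+1 * 2 ^ (t - a))))%N).
  apply: leq_sum => a _; apply: leq_add; last by rewrite mulnCA.
  apply: leq_trans (sum_pow8 a); rewrite (reindex_inj rev_ord_inj) /=.
  by apply: leq_sum => i _; rewrite subSS subKn // -ltnS.
rewrite big_split -!big_distrr /=.
have h1 : (8 ^ T <= 2 ^ t)%N by rewrite (_ : 8 = 2 ^ 3)%N // -expnM leq_exp2l // T3.
have h2 := sum_pow8 T.
have h3 : (T.+1 <= t.+1)%N by rewrite /T; lia.
have := sum_arith_geom h3; move: h1 h2.
move: (\sum_(_ < _) 8 ^ _)%N (\sum_(_ < _) _ * _)%N (8 ^ T)%N (2 ^ t)%N (_ * 2 ^ _)%N.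
lia.
Qed.

(** Either some arm lies on a line of at least 2^t points, or both lie on smaller lines; exchanging
    the arms gives four classes. The constant covers 2 * (576 * 24 + 1) = 27650. *)
Lemma card_right_angles t : (n <= 8 ^ t)%N -> (8 ^ t <= 8 * n)%N ->
  (#|right_angles pos| <= 28 * 1000 * (54 * 1024 * 9 * n ^ 2) * 2 ^ t)%N.
Proof.
move=> nt tn; set D := (54 * 1024 * 9 * n ^ 2)%N.
set m := (2 ^ t)%N; have m3 : (8 ^ t = m ^ 3)%N by rewrite /m -expnM mulnC expnM.
have hrich : (n * J m <= D * m)%N.
  have m2 : (m ^ 2 <= 8 * n)%N by apply: leq_trans tn; rewrite m3 leq_pexp2l // expn_gt0.
  have h := leq_mul (rich_incidences_small m2) (leqnn m).
  apply: leq_trans h; rewrite -mulnA -expnSr -m3 mulnC leq_mul2l nt orbT //.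
pose rich := [set u in right_angles pos | (m <= #|line_through pos u.1.2 u.2|)%N].
pose poor := [set u in right_angles pos | (#|line_through pos u.1.2 u.2| <=
      #|line_through pos u.1.2 u.1.1| < m)%N].
pose swap (u : V * V * V) := (u.2, u.1.2, u.1.1).
have swapK : involutive swap by move=> [[]].
pose F (i : bool * bool) := (if i.1 then swap @^-1: (if i.2 then rich else poor)
   else if i.2 then rich else poor).
have hpoor := card_poor_right_angles nt tn; rewrite -/D -/m -/poor in hpoor.
have hr := leq_trans (card_rich_right_angles pos_inj m) hrich; rewrite -/rich in hr.
apply: (@leq_trans (\sum_i #|F i|)).
  apply: card_le_sum_cover => -[[x q] y] ra.
  have ra' : (y, q, x) \in right_angles pos by move: ra; rewrite !finset.in_set /= perpC.
  have [hy|hy] := leqP m #|line_through pos q y|.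
    by exists (false, true); rewrite /F /= finset.in_set ra.
  have [hx|hx] := leqP m #|line_through pos q x|.
    by exists (true, true); rewrite /F /= finset.in_set /swap /= finset.in_set ra'.
  have [xy|yx] := leqP #|line_through pos q y| #|line_through pos q x|.
    by exists (false, false); rewrite /F /= finset.in_set ra /= xy.
  by exists (true, false); rewrite /F /= finset.in_set /swap /= finset.in_set ra' /= (ltnW yx).
have swapE (A : {set V * V * V}) : #|swap @^-1: A| = #|A|.
  exact: on_card_preimset (onW_bij _ (inv_bij swapK)).
rewrite (eq_bigr (fun i : bool * bool => if i.2 then #|rich| else #|poor|)); last first.
  by move=> [[] []] _; rewrite /F /= ?swapE.
rewrite -(pair_bigA _ (fun _ b => if b then #|rich| else #|poor|)) /= !big_bool /=.
move: hr hpoor; have -> : (28 * 1000 * D * m = 28 * 1000 * (D * m))%N by rewrite mulnA.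
have -> : (576 * D * (24 * m) = 576 * 24 * (D * m))%N by ring.
by move: (D * m)%N #|rich| #|poor|; lia.
Qed.

End DyadicCount.

(** * Right angle 2-chains *)

(** Cauchy-Schwarz, from the nonnegative square of [dot v v *: u - dot u v *: v]. *)
Lemma dot_sqr_le (R : realType) (d : nat) (u v : 'rV[R]_d) :
  dot u v ^+ 2 <= dot u u * dot v v.
Proof.
have [v0|vN] := eqVneq (dot v v) 0.
  by rewrite (dot_eq0 v0) -(scale0r 0) dotZr mul0r expr0n mulr_ge0 ?dot_ge0.
have vp : 0 < dot v v by rewrite lt_def vN dot_ge0.
have := dot_ge0 (dot v v *: u - dot u v *: v).
rewrite !(dotBl, dotBr, dotZl, dotZr) (dotC v u).
set a := dot u u; set b := dot u v; set c := dot v v in vp * => h.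
have : 0 <= c * (a * c - b ^+ 2) by move: h; congr (_ <= _); ring.
by rewrite pmulr_rge0 // subr_ge0.
Qed.

(* Cauchy-Schwarz keeps the argument of [acos] in [-1, 1]. *)
Lemma right_angle_dot (R : realType) (d : nat) (x y z : 'rV[R]_d) :
  right_angle x y z -> [/\ x != y, y != z & dot (x - y) (z - y) = 0].
Proof.
move=> /and3P[xy yz /eqP]; rewrite /angle /enorm; set u := x - y; set v := z - y => h.
split=> //.
have pos_dot w : w != 0 -> 0 < dot w w :> R.
  by move=> w0; rewrite lt_def dot_ge0 andbT; apply: contra_neq w0; exact: dot_eq0.
have up : 0 < dot u u by apply: pos_dot; rewrite subr_eq0.
have vp : 0 < dot v v by apply: pos_dot; rewrite subr_eq0 eq_sym.
set s := Num.sqrt (dot u u) * Num.sqrt (dot v v) in h.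
have sp : 0 < s by rewrite mulr_gt0 // sqrtr_gt0.
have le_s : `|dot u v| <= s.
  rewrite /s -sqrtrM ?dot_ge0 // -sqrtr_sqr ler_wsqrtr //; exact: dot_sqr_le.
have : cos (acos (dot u v / s)) = 0 by rewrite h cos_pihalf.
rewrite acosK; last first.
  by rewrite in_itv /= -ler_norml normrM [ `|s^-1| ]gtr0_norm ?invr_gt0 // ler_pdivrMr // mul1r.
by move/eqP; rewrite mulf_eq0 invr_eq0 (gt_eqF sp) orbF => /eqP.
Qed.

Lemma card_chains_le (R : realType) (p : nat) (E : {fset 'rV[R]_3}) :
  (forall P : set 'rV[R]_3, is_plane P ->
     (#|` [fset x in E | x \in P]%fset|%fset <= p)%N) ->
  (#|` right_angle_2chains E|%fset <= #|right_angles (val : E -> 'rV[R]_3)| * p)%N.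
Proof.
move=> planeE; set S := right_angle_2chains E; set RA := right_angles _.
have chainP (c : S) : exists t : E * E * E * E,
    [/\ val c = (val t.1.1.1, val t.1.1.2, val t.1.2, val t.2), t.1 \in RA &
      dot (val t.1.1.2 - val t.1.2) (val t.2) = dot (val t.1.1.2 - val t.1.2) (val t.1.2)].
  case: c => -[[[x1 x2] x3] x4] /=; rewrite !inE /=.
  move=> /andP[/andP[/andP[/andP[h1 h2] h3] h4] /andP[/right_angle_dot[n12 n23 o1]]].
  move=> /right_angle_dot[_ n34 o2].
  exists ([` h1]%fset, [` h2]%fset, [` h3]%fset, [` h4]%fset); split=> //=.
    by rewrite finset.in_set /perp /= -!val_eqE /= n12 eq_sym n23 o1 eqxx.
  by apply/eqP; rewrite -subr_eq0 -dotBr o2.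
have [f fP] := choice chainP.
pose F (t : E * E * E) := if t \in RA then [set c : S | (f c).1 == t] else finset.set0.
rewrite cardfE -cardsT; apply: (@leq_trans (\sum_t #|F t|)).
  by apply: card_le_sum_cover => c _; have [_ h _] := fP c; exists (f c).1; rewrite /F h inE.
rewrite -sum_nat_const [leqRHS]big_mkcond /=; apply: leq_sum => t _; rewrite /F.
case: ifP => [RAt|_]; last by rewrite cards0.
pose a := val t.1.2 - val t.2; pose P : set 'rV[R]_3 := [set x | dot a x = dot a (val t.2)]%classic.
have a0 : a != 0.
  move: RAt; rewrite finset.in_set => /and3P[_ h _].
  by rewrite subr_eq0 eq_sym; apply: contra_neq h => /val_inj.
apply: leq_trans (planeE P _); last by exists a, (dot a (val t.2)).
rewrite cardfE -cardsT.
(* Over a fixed right angle, a chain is determined by its last point, which lies in the plane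
   [P]. *)
apply: (@leq_card_rel _ _ _ _ (fun c y => val y = val (f c).2)).
  move=> c; rewrite inE => /eqP ct; have [_ _ h] := fP c.
  have yP : val (f c).2 \in [fset x in E | x \in P]%fset.
    by rewrite !inE /= fsvalP /=; apply/asboolP; rewrite /P /= /a -ct.
  by exists [` yP]%fset.
move=> c c' y; rewrite !inE => /eqP ct /eqP ct' yc yc'; apply: val_inj.
have [-> _ _] := fP c; have [-> _ _] := fP c'.
by rewrite ct ct' -yc -yc'.
Qed.

Lemma exists_pow8 n : (0 < n)%N -> exists t, (n <= 8 ^ t)%N && (8 ^ t <= 8 * n)%N.
Proof.
move=> n0; exists (trunc_log 8 n).+1; rewrite ltnW ?trunc_log_ltn //=.
by rewrite expnS leq_mul2l /= trunc_logP.
Qed.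

Theorem theorem4p1 (R : realType) :
  exists (C : R) (N : nat),
    forall (n p : nat) (E : {fset 'rV[R]_3}),
      (N < n)%N ->
      #|` E|%fset = n ->
      (forall P : set 'rV[R]_3, is_plane P ->
         (#|` [fset x in E | x \in P]%fset|%fset <= p)%N) ->
      (#|` right_angle_2chains E|%fset)%:R <= C * (p%:R * n%:R `^ (7 / 3)).
Proof.
have [K hK] : exists K : nat, forall (V : finType) (pos : V -> 'rV[R]_3) (t : nat),
    injective pos -> (#|V| <= 8 ^ t)%N -> (8 ^ t <= 8 * #|V|)%N ->
    (#|right_angles pos| <= K * (#|V| ^ 2 * 2 ^ t))%N.
  exists (28 * 1000 * (54 * 1024 * 9))%N => V pos t pos_inj Vt tV.
  have assoc (c c' u v : nat) : (c * (c' * u) * v = c * c' * (u * v))%N by ring.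
  by have := card_right_angles pos_inj Vt tV; rewrite assoc => h; exact: h.
(* The 2 is the loss in 2^t <= 2 n^(1/3), the cube root of 8^t <= 8n. *)
exists (2 * K)%N%:R, 0%N => n p E n0 En planeE.
have [t /andP[nt tn]] := exists_pow8 n0.
have nV : #|{: E}| = n by rewrite -cardfE.
have := hK E val t val_inj; rewrite nV => /(_ nt tn) hRA.
have h := leq_trans (card_chains_le planeE) (leq_mul hRA (leqnn p)).
have {}h : (#|` right_angle_2chains E|%fset <= K * (n ^ 2 * 2 ^ t * p))%N.
  by apply: (leq_trans h); rewrite !mulnA.
have n0R : 0 < n%:R :> R by rewrite ltr0n.
have t_le : (2 ^ t)%:R <= 2 * n%:R `^ (3^-1) :> R.
  have r0 : 0 <= n%:R `^ (3^-1) :> R by exact: powR_ge0.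
  rewrite -(@ler_pXn2r _ 3) ?nnegrE ?mulr_ge0 ?ler0n // exprMn -(powR_mulrn 3 r0).
  rewrite -powRrM mulVf ?pnatr_eq0 // powRr1 ?ler0n // -!natrX -natrM ler_nat.
  by rewrite -expnM mulnC expnM.
have n73 : n%:R `^ (7 / 3) = n%:R ^+ 2 * n%:R `^ (3^-1) :> R.
  rewrite (_ : 7 / 3 = 2 + 3^-1); last by field.
  by rewrite powRD ?powR_mulrn ?ler0n // gt_eqF ?implybT.
apply: (@le_trans _ _ (K * (n ^ 2 * 2 ^ t * p))%N%:R); first by rewrite ler_nat.
rewrite n73 !natrM.
have : K%:R * (n%:R ^+ 2 * p%:R) * (2 ^ t)%:R <= K%:R * (n%:R ^+ 2 * p%:R) * (2 * n%:R `^ (3^-1)) :> R.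
  by rewrite ler_wpM2l // !mulr_ge0 ?exprn_ge0 ?ler0n.
by move: K%:R (n%:R) (p%:R) ((2 ^ t)%:R) (_ `^ _) => k u v w r; lra.
Qed.
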